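(* Let $n>2$ be an integer and let $f\in C^{1}(0,\infty)\cap C[0,\infty)$ be a real-valued function having at least one zero in $[0,\infty)$. Suppose that for some $\beta\in\left(1,\frac{n+2}{n-2}\right)$, $$\beta f(s)-s f'(s)\ge 0\quad\text{for all } s>0.$$ Consider the equation $$\Delta u+f(u)=0\quad\text{in }\mathbb{R}^{n}.$$ Then the following hold. (i) If $n=3$, then every bounded smooth positive solution $u$ of the equation is constant. (ii) If $n\ge 4$ and there exists some $\alpha>1$ such that $f(s)\ge s^{\alpha}$ for all sufficiently large $s$, then the equation admits no smooth positive solution. Moreover, the only trivial (nonnegative constant) solution is $u\equiv 0$.
   Context: $\Delta$ is the usual Laplacian on $\mathbb{R}^n$. Solutions are classical and defined on all of $\mathbb{R}^n$; a positive solution is one with $u(x)>0$ for every $x\in\mathbb{R}^n$. The function $f$ is allowed to change sign. *)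

(* Defs.v *)
From HB Require Import structures.
From mathcomp Require Import all_boot all_order all_algebra.
From mathcomp Require Import all_classical all_reals all_analysis.

Set Implicit Arguments.
Unset Strict Implicit.
Unset Printing Implicit Defensive.

Import Order.TTheory GRing.Theory Num.Theory numFieldNormedType.Exports.
Local Open Scope classical_set_scope.
Local Open Scope ring_scope.

Definition partial (R : realType) (n : nat) (i : 'I_n) (u : 'rV[R]_n -> R) :
  'rV[R]_n -> R := 'D_(delta_mx 0 i) u.

(* The norm on row vectors is the sup norm; it induces the Euclidean
   topology, so [continuous] has its usual meaning. *)
Definition C1 (R : realType) (n : nat) (u : 'rV[R]_n -> R) : Prop :=
  continuous u /\
  forall i : 'I_n,
    (forall x, derivable u x (delta_mx 0 i)) /\ continuous (partial i u).

Definition C2 (R : realType) (n : nat) (u : 'rV[R]_n -> R) : Prop :=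
  C1 u /\ forall i : 'I_n, C1 (partial i u).

Definition laplacian (R : realType) (n : nat) (u : 'rV[R]_n -> R)
  (x : 'rV[R]_n) : R := \sum_(i < n) partial i (partial i u) x.

(* Classical solutions of Delta u + f(u) = 0.  Since f is only C^1, the
   natural regularity of a classical solution is C^2. *)
Definition classical_solution (R : realType) (n : nat) (f : R -> R)
  (u : 'rV[R]_n -> R) : Prop :=
  C2 u /\ forall x, laplacian u x + f (u x) = 0.

Definition positive_solution (R : realType) (n : nat) (f : R -> R)
  (u : 'rV[R]_n -> R) : Prop :=
  classical_solution f u /\ forall x, 0 < u x.

(* Main.v *)
Require Import Defs.
From HB Require Import structures.
From mathcomp Require Import all_boot all_order all_algebra.
From mathcomp Require Import all_classical all_reals all_analysis.
From mathcomp Require Import ring lra.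
Set Implicit Arguments.
Unset Strict Implicit.
Unset Printing Implicit Defensive.
Import Order.TTheory GRing.Theory Num.Theory numFieldNormedType.Exports.
Local Open Scope classical_set_scope.
Local Open Scope ring_scope.

(* Put [p = Du], [a = - 2 / (n - 2)], [c = - n / (n - 2)], and let [E] be the
   trace-free part of [D^2 u + c (p (x) p) / u].  Bochner's formula gives
     div (u^a E p) = u^a (|E|^2 + (1 - 1/n) ((n+2)/(n-2) f(u)/u - f'(u)) |p|^2),
   whose right-hand side is nonnegative where [f (u) >= 0].  Testing it against
   powers of a cutoff [rho] at scale [L] bounds the integral of
   [rho^m u^a (|E|^2 + f(u) |p|^2 / u)] by that of [L^-2 rho^(m-2) u^a |p|^2].

   If n = 3 and u is bounded, the maximum principle gives [f (u) >= 0], so that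
   [u] is superharmonic and the integral of [|D ln u|^2] over a ball of radius
   [L] is O(L); hence [E = 0] and [f (u) p = 0], which makes [u] harmonic, and
   then constant.  If n >= 4, then [f > 0], and testing the equation with
   [f (u) u^a] and with powers of [u] bounds the integral of [rho^m u^a f(u)^2]
   by a negative power of [L], since beta is subcritical. *)

(** * Partial derivatives along coordinate directions *)

Section Calculus.
Context {R : realType} {n : nat}.
Local Notation V := 'rV[R]_n.
Implicit Types (phi psi u : V -> R) (i j : 'I_n).

Local Notation e i := (delta_mx 0 i : V).

(** Every estimate is a pointwise inequality modulo a function whose Riemann sums over a cube tend
    to 0, so no integral of its terms is ever formed. The hypothesis on [f] acts in two ways:
    [u f'(u) <= beta f(u)] leaves at least [((n+2)/(n-2) - beta) f(u)/u] of the zero-order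
    coefficient in Bochner's formula, and [f(s) / s^beta] is nonincreasing, which bounds [f] from
    below near 0 and keeps it negative to the right of any point where it is negative. For n >= 4
    nothing bounds [u]. The term [L^-2 u^a |Du|^2] is traded for [L^-4 u^(a+2)] and
    [L^-2 u^(a+1) f(u)], and Young's inequality with [f(u) >= C u^q] turns these into a small
    multiple of [u^a f(u)^2] plus a constant times [L^-(4 + 4 (a+2)/(2q-2))]. At the critical [q]
    this power is [L^-(n+1)], one better than the volume requires. The spare room pays for an
    obstacle in dimension 4: there [a + 1 = 0], so the test function [u^(a+1)] is constant and sees
    no gradient. All exponents are therefore shifted by a small [delta] in both directions. *)

Definition C1_along i phi (dphi : V -> R) : Prop :=
  [/\ continuous phi, continuous dphi &
      forall x, is_derive x (e i) phi (dphi x)].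

Lemma C1_along_eq i phi psi dphi dpsi :
  C1_along i phi dphi -> phi =1 psi -> dphi =1 dpsi -> C1_along i psi dpsi.
Proof. by move=> h /funext <- /funext <-. Qed.

Lemma C1_along_cst i (c : R) : C1_along i (fun=> c) (fun=> 0).
Proof. by split; [exact: cst_continuous|exact: cst_continuous|move=> x; exact: is_derive_cst]. Qed.

Lemma C1_alongD i phi psi dphi dpsi :
  C1_along i phi dphi -> C1_along i psi dpsi ->
  C1_along i (fun x => phi x + psi x) (fun x => dphi x + dpsi x).
Proof.
move=> [c1 c2 c3] [d1 d2 d3]; split=> x.
- exact: (cvgD (c1 x) (d1 x)).
- exact: (cvgD (c2 x) (d2 x)).
- exact: is_deriveD.
Qed.

Lemma C1_alongM i phi psi dphi dpsi :
  C1_along i phi dphi -> C1_along i psi dpsi ->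
  C1_along i (fun x => phi x * psi x) (fun x => phi x * dpsi x + psi x * dphi x).
Proof.
move=> [c1 c2 c3] [d1 d2 d3]; split=> x.
- exact: (cvgM (c1 x) (d1 x)).
- exact: (cvgD (cvgM (c1 x) (d2 x)) (cvgM (d1 x) (c2 x))).
- exact: is_deriveM.
Qed.

Lemma C1_alongZ i (c : R) phi dphi :
  C1_along i phi dphi -> C1_along i (fun x => c * phi x) (fun x => c * dphi x).
Proof.
move=> h; apply: (C1_along_eq (C1_alongM (C1_along_cst i c) h)) => // x.
by rewrite mulr0 addr0.
Qed.

Lemma C1_along_sum i (I : finType) (phi dphi : I -> V -> R) :
  (forall k, C1_along i (phi k) (dphi k)) ->
  C1_along i (fun x => \sum_k phi k x) (fun x => \sum_k dphi k x).
Proof.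
move=> h; elim: (index_enum I) => [|k s ih].
  apply: (C1_along_eq (C1_along_cst i 0)) => x; by rewrite big_nil.
by apply: (C1_along_eq (C1_alongD (h k) ih)) => x; rewrite big_cons.
Qed.

Lemma is_derive_line (phi : V -> R) (v x : V) (t d : R) :
  is_derive (t *: v + x) v phi d ->
  is_derive t 1 (fun s : R => phi (s *: v + x)) d.
Proof.
have E : (fun h : R => h^-1 *: ((phi \o shift (t *: v + x)) (h *: v) - phi (t *: v + x)))
  = (fun h : R => h^-1 *: (((fun s : R => phi (s *: v + x)) \o shift t) (h *: (1:R)) - phi (t *: v + x))).
  by apply/funext => h /=; rewrite scalerDl addrA [_%:A]mulr1.
move=> [h1 h2]; split.
  by move: h1; rewrite /derivable E.
by move: h2; rewrite /derive E.
Qed.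

Lemma is_derive_from_line (phi : V -> R) (v x : V) (d : R) :
  is_derive 0 (1:R) (fun s : R => phi (s *: v + x)) d -> is_derive x v phi d.
Proof.
have E : (fun h : R => h^-1 *: ((phi \o shift x) (h *: v) - phi x))
  = (fun h : R => h^-1 *: (((fun s : R => phi (s *: v + x)) \o shift 0) (h *: (1:R)) - phi (0 *: v + x))).
  by apply/funext => h /=; rewrite scale0r add0r addr0 [_%:A]mulr1.
move=> [h1 h2]; split.
  by move: h1; rewrite /derivable -E.
by move: h2; rewrite /derive -E.
Qed.

Lemma C1_along_comp i (g dg : R -> R) phi dphi :
  (forall x, is_derive (phi x) 1 g (dg (phi x))) ->
  (forall x, {for phi x, continuous dg}) ->
  C1_along i phi dphi ->
  C1_along i (fun x => g (phi x)) (fun x => dg (phi x) * dphi x).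
Proof.
move=> dgP cdg [c1 c2 c3]; split=> x.
- apply: continuous_comp; first exact: c1.
  by apply: differentiable_continuous; apply/derivable1_diffP; case: (dgP x).
- by apply: (cvgM _ (c2 x)); apply: continuous_comp; [exact: c1|exact: cdg].
- apply: is_derive_from_line.
  have h0 : is_derive (0:R) 1 (fun s : R => phi (s *: e i + x)) (dphi x).
    by apply: is_derive_line; rewrite scale0r add0r.
  apply: (is_derive1_comp (f := g)).
  by rewrite scale0r add0r.
Qed.

Lemma mvt_along i phi dphi (x : V) (h : R) :
  C1_along i phi dphi -> 0 < h ->
  exists2 t, 0 < t < h & phi (h *: e i + x) - phi x = dphi (t *: e i + x) * h.
Proof.
move=> [c1 c2 c3] h0.
have cl : {within `[0, h], continuous (fun s : R => phi (s *: e i + x))}.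
  apply: continuous_subspaceT => s.
  apply: continuous_comp; last exact: c1.
  by apply: cvgD; [apply: cvgZr_tmp; exact: cvg_id|exact: cvg_cst].
have [t th E] := MVT h0 (fun s _ => is_derive_line (c3 (s *: e i + x))) cl.
exists t; first by move: th; rewrite in_itv.
by move: E; rewrite scale0r add0r subr0.
Qed.

End Calculus.

(** * Riemann sums and summation by parts *)

Section RiemannSums.
Context {R : realType} {n : nat}.
Local Notation V := 'rV[R]_n.
Implicit Types (phi psi D : V -> R) (i j : 'I_n).
Local Notation e i := (delta_mx 0 i : V).
Variables (z : V) (L : nat).

Definition box : set V := [set x | forall i, `|x 0 i - z 0 i| <= L%:R].

(** [L] is a natural number so that the mesh [1 / N.+1] divides the side [2 L]. Both end points of
    each side belong to the grid, hence the [.+1] in the index type. *)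
Definition gridpt (N : nat) (k : {ffun 'I_n -> 'I_(2 * L * N.+1).+1}) : V :=
  \row_i (z 0 i - L%:R + (k i)%:R / N.+1%:R).

Definition gridsum (N : nat) phi : R :=
  N.+1%:R ^- n * \sum_(k : {ffun 'I_n -> 'I_(2 * L * N.+1).+1}) phi (gridpt k).

Lemma compact_box : compact box.
Proof.
pose A i : set R := [set` `[z 0 i - L%:R, z 0 i + L%:R]%R].
have -> : box = [set v | forall i, A i (v ord0 i)].
  by apply/seteqP; split => x /= h i; have := h i; rewrite /A /= in_itv /= ler_distl.
exact: (@rV_compact R n A (fun i => @segment_compact R _ _)).
Qed.

Lemma gridpt_box N k : box (@gridpt N k).
Proof.
move=> i; rewrite mxE.
have k0 : 0 <= (k i)%:R / N.+1%:R :> R by rewrite divr_ge0.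
have k1 : (k i)%:R / N.+1%:R <= 2 * L%:R :> R.
  rewrite ler_pdivrMr ?ltr0n// -!natrM ler_nat.
  by have := ltn_ord (k i); rewrite ltnS.
move: (_ / _) k0 k1 => q q0 q1.
by rewrite ler_norml; apply/andP; split; lra.
Qed.

Lemma le_gridsum N phi psi :
  (forall x, box x -> phi x <= psi x) -> gridsum N phi <= gridsum N psi.
Proof.
move=> h; rewrite /gridsum ler_wpM2l ?invr_ge0 ?exprn_ge0//.
by apply: ler_sum => k _; apply: h; exact: gridpt_box.
Qed.

Lemma gridsumD N phi psi :
  gridsum N (fun x => phi x + psi x) = gridsum N phi + gridsum N psi.
Proof. by rewrite /gridsum -mulrDr big_split. Qed.

Lemma gridsumZ N (c : R) phi : gridsum N (fun x => c * phi x) = c * gridsum N phi.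
Proof. by rewrite /gridsum mulrCA -mulr_sumr. Qed.

(** Each side carries one more point than it has cells, so the sum overshoots the volume [(2 L)^n];
    [2 L + 1] is a bound uniform in [N]. *)
Lemma gridsum_cst_le N (c : R) :
  0 <= c -> gridsum N (fun=> c) <= c * (2 * L%:R + 1) ^+ n.
Proof.
move=> c0; rewrite /gridsum sumr_const card_ffun !card_ord -[c *+ _]mulr_natl.
rewrite mulrA [leRHS]mulrC ler_wpM2r//.
rewrite natrX -exprVn -exprMn; apply: lerXn2r; rewrite ?nnegrE ?mulr_ge0 ?addr_ge0 ?mulr_ge0 ?invr_ge0//.
rewrite ler_pdivrMl ?ltr0n// -natr1 natrM natrM -[N.+1%:R]natr1.
have L0 : 0 <= L%:R :> R by []. have N0 : 0 <= N%:R :> R by [].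
by nra.
Qed.

Lemma gridsum_norm_le N phi (c : R) : 0 <= c ->
  (forall x, box x -> `|phi x| <= c) -> `|gridsum N phi| <= c * (2 * L%:R + 1) ^+ n.
Proof.
move=> c0 h; rewrite ler_norml; apply/andP; split.
  have := @le_gridsum N (fun x => - 1 * phi x) (fun=> c).
  rewrite gridsumZ => hh; rewrite lerNl -mulN1r.
  apply: (le_trans _ (gridsum_cst_le N c0)); apply: hh => x bx.
  by rewrite mulN1r lerNl; have := h x bx; rewrite ler_norml => /andP[].
apply: (le_trans _ (gridsum_cst_le N c0)); apply: le_gridsum => x bx.
by have := h x bx; rewrite ler_norml => /andP[].
Qed.

(* [null D] plays the role of [the integral of D over the box is 0]; it needs no
   integration theory on R^n. *)
Definition null D : Prop := gridsum N D @[N --> \oo] --> (0 : R).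

Lemma null_eq D D' : null D -> D =1 D' -> null D'.
Proof. by move=> h /funext <-. Qed.

Lemma nullD D D' : null D -> null D' -> null (fun x => D x + D' x).
Proof.
move=> h h'; rewrite /null; under eq_fun do rewrite gridsumD.
by rewrite -[0]addr0; exact: cvgD.
Qed.

Lemma nullZ (c : R) D : null D -> null (fun x => c * D x).
Proof.
move=> h; rewrite /null; under eq_fun do rewrite gridsumZ.
by rewrite -[0](mulr0 c); exact: (cvgM (cvg_cst c) h).
Qed.

Lemma null_sum (I : finType) (D : I -> V -> R) :
  (forall k, null (D k)) -> null (fun x => \sum_k D k x).
Proof.
move=> h; elim: (index_enum I) => [|k s ih].
  apply: (@null_eq (fun=> 0 * 0)); last by move=> x; rewrite big_nil mul0r.
  rewrite /null; under eq_fun do rewrite gridsumZ mul0r.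
  exact: cvg_cst.
by apply: (null_eq (nullD (h k) ih)) => x; rewrite big_cons.
Qed.

(** Riemann sums are controlled by the sup norm uniformly in [N], so null functions are closed under
    uniform limits. *)
Lemma null_approx D :
  (forall eps : R, 0 < eps -> exists2 D', null D' &
     forall x, box x -> `|D x - D' x| <= eps) -> null D.
Proof.
move=> h; apply/cvgr0Pnorm_le => eps eps0.
have c0 : 0 < (2 * L%:R + 1) ^+ n :> R.
  by rewrite exprn_gt0// ltr_wpDl// mulr_ge0.
have [D' nD' DD'] := h (eps / 2 / (2 * L%:R + 1) ^+ n) ltac:(by rewrite !divr_gt0).
have /cvgr0Pnorm_le /(_ (eps / 2)) nD'2 := nD'.
have := nD'2 ltac:(by rewrite divr_gt0); apply: filterS => N hN.
have -> : gridsum N D = gridsum N (fun x => D x - D' x) + gridsum N D'.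
  by rewrite -gridsumD; congr gridsum; apply/funext => x; rewrite subrK.
apply: (le_trans (ler_normD _ _)).
rewrite [leRHS](splitr eps); apply: lerD => //.
apply: (le_trans (gridsum_norm_le _ _ DD')); last by rewrite divfK// gt_eqF.
by rewrite !divr_ge0// ltW.
Qed.

(* The shift by one grid step in direction [i] is a cyclic permutation of the
   grid, up to points where [phi] vanishes. *)
Lemma gridsum_shift N i phi :
  (forall x : V, (exists j, L%:R <= `|x 0 j - z 0 j|) -> phi x = 0) ->
  gridsum N (fun x => phi (N.+1%:R^-1 *: e i + x)) = gridsum N phi.
Proof.
move=> phi0; rewrite /gridsum; congr (_ * _).
pose s (g : 'I_(2 * L * N.+1).+1 -> 'I_(2 * L * N.+1).+1)
       (k : {ffun 'I_n -> 'I_(2 * L * N.+1).+1}) :=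
  [ffun j => if j == i then g (k j) else k j].
have sb : bijective (s (@ordS _)).
  exists (s (@ord_pred _)) => k; apply/ffunP => j; rewrite !ffunE;
    by case: eqP => // _; rewrite ?ordSK ?ord_predK.
rewrite [RHS](reindex _ (onW_bij _ sb)) /=; apply: eq_bigr => k _.
have N0 : N.+1%:R != 0 :> R by rewrite pnatr_eq0.
have [lt|ge] := ltnP (k i).+1 (2 * L * N.+1)%N.+1.
  congr phi; apply/rowP => j; rewrite !mxE !ffunE eqxx /=.
  case: eqP => [->|_]; last by rewrite mulr0 add0r.
  rewrite /= modn_small// -natr1 mulr1.
  by field; rewrite natr1 pnatr_eq0.
have ki : (k i : nat) = (2 * L * N.+1)%N :> nat.
  by apply/eqP; rewrite eqn_leq; have := ltn_ord (k i); rewrite ltnS => -> /=.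
rewrite !phi0//; exists i; rewrite !mxE ?ffunE !eqxx /= ki.
  rewrite modnn mul0r addr0 addrAC subrr add0r normrN ger0_norm//.
rewrite natrM mulfK// natrM mulr1.
have h0 : 0 <= (N.+1%:R : R)^-1 by rewrite invr_ge0.
rewrite (le_trans _ (ler_norm _))//.
by move: (_^-1) h0 => h h0; lra.
Qed.

(** By the mean value theorem the quotient is a value of [dphi] at a point within [h] of [x],
    possibly outside the cube; compactness makes the modulus of continuity of [dphi] uniform over
    the cube. *)
Lemma unif_diffquot i phi dphi : C1_along i phi dphi ->
  forall eps : R, 0 < eps -> exists2 d : R, 0 < d &
    forall h, 0 < h < d -> forall x, box x ->
      `|(phi (h *: e i + x) - phi x) / h - dphi x| <= eps.
Proof.
move=> hphi eps eps0; have [c1 c2 c3] := hphi.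
have /compact_near_coveringP cov := compact_box.
have : \forall t \near (0 : R),
    box `<=` (fun x => `|dphi (t *: e i + x) - dphi x| <= eps).
  apply: (cov R (nbhs (0 : R)) (fun t x => `|dphi (t *: e i + x) - dphi x| <= eps)) => x _.
  have ct : (fun p : V * R => dphi (p.2 *: e i + p.1) - dphi p.1) p
      @[p --> (x, 0 : R)] --> dphi (0 *: e i + x) - dphi x.
    apply: cvgB; apply: continuous_cvg; try exact: c2; last exact: cvg_fst.
    apply: cvgD; last exact: cvg_fst.
    apply: cvgZr_tmp; exact: cvg_snd.
  move: ct; rewrite scale0r add0r subrr => /cvgr0Pnorm_le/(_ _ eps0).
  by [].
move=> /nbhs_ballP[d d0 hd]; exists d => // h /andP[h0 hd'] x bx.
have [t /andP[t0 th] ->] := mvt_along x hphi h0.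
rewrite mulfK ?gt_eqF//; apply: (hd t _ x bx).
by rewrite /ball /= sub0r normrN gtr0_norm// (lt_trans th).
Qed.

(** The substitute for the divergence theorem. The difference quotient whose step is the mesh has
    Riemann sum exactly 0, by shift invariance, and it is uniformly close to [dphi]. *)
Lemma null_partial i phi dphi : C1_along i phi dphi ->
  (forall x : V, (exists j, L%:R <= `|x 0 j - z 0 j|) -> phi x = 0) ->
  null dphi.
Proof.
move=> hphi phi0; apply/cvgr0Pnorm_le => eps eps0.
have c0 : 0 < (2 * L%:R + 1) ^+ n :> R.
  by rewrite exprn_gt0// ltr_wpDl// mulr_ge0.
have e0 : 0 < eps / (2 * L%:R + 1) ^+ n by rewrite divr_gt0.
have [d d0 hd] := unif_diffquot hphi e0.
have := near_infty_natSinv_lt (PosNum d0); apply: filterS => N /= hN.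
have -> : gridsum N dphi = gridsum N (fun x => dphi x -
    (phi (N.+1%:R^-1 *: e i + x) - phi x) / N.+1%:R^-1).
  have -> : (fun x => dphi x - (phi (N.+1%:R^-1 *: e i + x) - phi x) / N.+1%:R^-1)
     = (fun x => dphi x + (- (N.+1%:R)) * ((phi (N.+1%:R^-1 *: e i + x) + (-1) * phi x))).
    by apply/funext => x; rewrite invrK; ring.
  by rewrite gridsumD gridsumZ gridsumD gridsum_shift// gridsumZ mulN1r subrr mulr0 addr0.
rewrite (le_trans (gridsum_norm_le (c := eps / (2 * L%:R + 1) ^+ n) _ _ _))//.
- exact: ltW.
- by move=> x bx; rewrite distrC; apply: hd => //; rewrite invr_gt0 ltr0n /= hN.
- by rewrite divfK// gt_eqF.
Qed.

End RiemannSums.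

(** * Bounds for Riemann sums, and uniform limits on the cube *)

Section RiemannSumBounds.
Context {R : realType} {n : nat}.
Local Notation V := 'rV[R]_n.
Implicit Types (phi psi D A : V -> R) (i j : 'I_n).
Local Notation e i := (delta_mx 0 i : V).
Variables (z : V) (L : nat).
Local Notation gridsum := (gridsum z L).
Local Notation box := (box z L).
Local Notation null := (null z L).

Lemma gridsum_ge N A (c r : R) : 0 <= c -> 0 <= r <= L%:R ->
  (forall x, box x -> 0 <= A x) ->
  (forall x : V, (forall i, `|x 0 i - z 0 i| <= r) -> c <= A x) ->
  c * r ^+ n <= gridsum N A.
Proof.
move=> c0 /andP[r0 rL] A0 cA.
pose M := (2 * L * N.+1)%N.+1.
pose K := Num.truncn (r * N.+1%:R).
have rN0 : 0 <= r * N.+1%:R by rewrite mulr_ge0.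
have /andP[Kr rK] := Num.Theory.truncn_itv rN0.
have KL : (K <= L * N.+1)%N.
  by rewrite -(ler_nat R) natrM (le_trans Kr)// ler_wpM2r.
have KM (t : 'I_K.+1) : (L * N.+1 + t < M)%N.
  rewrite /M ltnS -mulnA mul2n -addnn leq_add2l (leq_trans _ KL)//.
  by rewrite -ltnS.
(* These indices give the grid points with [0 <= x i - z i <= r]. There are [K.+1 > r * N.+1] of
   them in each direction, which already yields the factor [r ^+ n]. *)
pose J : pred 'I_M := [pred j : 'I_M | L * N.+1 <= j <= L * N.+1 + K]%N.
have cJ : (K.+1 <= #|J|)%N.
  have inj : injective (fun t => Ordinal (KM t)).
    by move=> s t /(congr1 val) /= /addnI /val_inj.
  rewrite -[K.+1]card_ord -(card_codom inj); apply: subset_leq_card.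
  apply/fintype.subsetP => _ /codomP[t ->]; rewrite !inE /= leq_addr leq_add2l /=.
  by rewrite -ltnS.
rewrite /gridsum ler_pdivlMl ?exprn_gt0//.
apply: (@le_trans _ _ (\sum_(k in ffun_on J) A (gridpt z k))); last first.
  rewrite [leRHS](bigID (mem (ffun_on J))) /= lerDl; apply: sumr_ge0 => k _.
  by apply: A0; exact: gridpt_box.
apply: (@le_trans _ _ (\sum_(k : {ffun 'I_n -> 'I_M} | k \in ffun_on J) c)).
  rewrite sumr_const card_ffun_on card_ord -[c *+ _]mulr_natl.
  rewrite mulrCA -exprMn mulrC ler_wpM2r// natrX lerXn2r ?nnegrE ?mulr_ge0//.
  rewrite mulrC (le_trans (ltW rK))// ler_nat//.
apply: ler_sum => k /ffun_onP kJ; apply: cA => i.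
rewrite mxE; have := kJ i; rewrite inE /= => /andP[k1 k2].
have N0 : 0 < N.+1%:R :> R by rewrite ltr0n.
have q1 : L%:R <= (k i)%:R / N.+1%:R :> R.
  by rewrite ler_pdivlMr// -natrM ler_nat.
have q2 : (k i)%:R / N.+1%:R <= L%:R + r :> R.
  rewrite ler_pdivrMr// mulrDl -natrM.
  apply: (@le_trans _ _ ((L * N.+1 + K)%:R)); first by rewrite ler_nat.
  by rewrite natrD lerD2l.
move: (_ / _) q1 q2 => q q1 q2.
by rewrite ger0_norm; lra.
Qed.

(** Summing over one sufficiently fine grid turns a pointwise inequality modulo a null function into
    an inequality between numbers. *)
Lemma null_lower_bound D A (K c r : R) :
  null D -> (forall x, box x -> A x <= D x + K) -> 0 <= K ->
  (forall x, box x -> 0 <= A x) ->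
  0 <= c -> 0 <= r <= L%:R ->
  (forall x : V, (forall i, `|x 0 i - z 0 i| <= r) -> c <= A x) ->
  c * r ^+ n <= K * (2 * L%:R + 1) ^+ n.
Proof.
move=> nD AD K0 A0 c0 rL cA; apply/ler_addgt0Pr => eps eps0.
have /cvgr0Pnorm_le /(_ _ eps0) /filter_ex [N hN] := nD.
apply: (le_trans (gridsum_ge N c0 rL A0 cA)).
apply: (le_trans (le_gridsum N AD)).
rewrite gridsumD addrC; apply: lerD; first exact: gridsum_cst_le.
exact: le_trans (ler_norm _) hN.
Qed.

Lemma box_bounded phi : continuous phi ->
  exists2 M, 0 <= M & forall x, box x -> `|phi x| <= M.
Proof.
move=> cphi; have : compact (phi @` box).
  by apply: continuous_compact; [exact: continuous_subspaceT|exact: compact_box].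
move=> /compact_bounded [M [_ hM]]; exists (`|M| + 1); first by rewrite addr_ge0.
move=> x bx; apply: (hM (`|M| + 1)); last by exists x.
by rewrite (le_lt_trans (ler_norm _))// ltrDl.
Qed.

(** Continuity of the limit is included because it bounds the limit on the cube, as the product rule
    requires. *)
Definition unif_lim (F : R -> V -> R) phi : Prop :=
  continuous phi /\
  forall eps : R, 0 < eps -> exists2 d : R, 0 < d &
    forall h, 0 < h < d -> forall x, box x -> `|F h x - phi x| <= eps.

Lemma unif_lim_cst phi : continuous phi -> unif_lim (fun=> phi) phi.
Proof.
by split=> // eps e0; exists 1 => // h _ x _; rewrite subrr normr0 ltW.
Qed.

Lemma unif_limD F G phi psi : unif_lim F phi -> unif_lim G psi ->
  unif_lim (fun h x => F h x + G h x) (fun x => phi x + psi x).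
Proof.
move=> [cphi hF] [cpsi hG]; split=> [x|eps e0].
  exact: (cvgD (cphi x) (cpsi x)).
have e2 : 0 < eps / 2 by rewrite divr_gt0.
have [d d0 hd] := hF _ e2; have [d' d'0 hd'] := hG _ e2.
exists (Num.min d d') => [|h]; first by rewrite lt_min d0.
rewrite lt_min => /and3P[h0 h1 h2] x bx.
rewrite opprD addrACA (le_trans (ler_normD _ _))// [leRHS]splitr.
by apply: lerD; [apply: hd|apply: hd'] => //; rewrite h0.
Qed.

Lemma unif_limM F G phi psi : unif_lim F phi -> unif_lim G psi ->
  unif_lim (fun h x => F h x * G h x) (fun x => phi x * psi x).
Proof.
move=> [cphi hF] [cpsi hG]; split=> [x|eps e0].
  exact: (cvgM (cphi x) (cpsi x)).
have [M M0 hM] := box_bounded cphi; have [M' M'0 hM'] := box_bounded cpsi.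
have e2 : 0 < Num.min 1 (eps / (1 + M + M')).
  by rewrite lt_min ltr01 divr_gt0//; lra.
have [d d0 hd] := hF _ e2; have [d' d'0 hd'] := hG _ e2.
exists (Num.min d d') => [|h]; first by rewrite lt_min d0.
rewrite lt_min => /and3P[h0 h1 h2] x bx.
have := hd h; rewrite h0 h1 => /(_ isT x bx); rewrite le_min => /andP[a1 a2].
have := hd' h; rewrite h0 h2 => /(_ isT x bx); rewrite le_min => /andP[b1 b2].
have -> : F h x * G h x - phi x * psi x = (F h x - phi x) * (G h x - psi x)
  + phi x * (G h x - psi x) + psi x * (F h x - phi x) by ring.
apply: (le_trans (ler_normD _ _)); rewrite normrM.
apply: (le_trans (lerD (ler_normD _ _) (lexx _))); rewrite !normrM.
have p1 := hM x bx; have q1 := hM' x bx.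
set p := `|phi x| in p1 *; set q := `|psi x| in q1 *.
set a := `|_ - phi x| in a1 a2 *; set b := `|_ - psi x| in b1 b2 *.
have p0 : 0 <= p by exact: normr_ge0.
have q0 : 0 <= q by exact: normr_ge0.
have a0 : 0 <= a by exact: normr_ge0.
have b0 : 0 <= b by exact: normr_ge0.
have m0 : 0 < 1 + M + M' by lra.
set E := eps / _ in a2 b2.
have -> : eps = E * (1 + M + M') by rewrite /E divfK ?gt_eqF.
have E0 : 0 <= E by lra.
have h3 : a * b <= 1 * E by exact: ler_pM.
have h4 : p * b <= M * E by exact: ler_pM.
have h5 : q * a <= M' * E by exact: ler_pM.
lra.
Qed.

Lemma unif_lim_sum (I : finType) (F : I -> R -> V -> R) (phi : I -> V -> R) :
  (forall k, unif_lim (F k) (phi k)) ->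
  unif_lim (fun h x => \sum_k F k h x) (fun x => \sum_k phi k x).
Proof.
move=> h; elim: (index_enum I) => [|k s ih].
  under eq_fun do under eq_fun do rewrite big_nil.
  under [X in unif_lim _ X]eq_fun do rewrite big_nil.
  by apply: unif_lim_cst; exact: cst_continuous.
under eq_fun do under eq_fun do rewrite big_cons.
under [X in unif_lim _ X]eq_fun do rewrite big_cons.
exact: unif_limD.
Qed.

End RiemannSumBounds.

(** * Bochner's formula in weak form *)

Section SecondOrder.
Context {R : realType} {n : nat}.
Local Notation V := 'rV[R]_n.
Implicit Types (phi psi D A : V -> R) (i j : 'I_n).
Local Notation e i := (delta_mx 0 i : V).

Lemma C1_along_shift i phi dphi (w : V) : C1_along i phi dphi ->
  C1_along i (fun x => phi (w + x)) (fun x => dphi (w + x)).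
Proof.
move=> [c1 c2 c3].
have cw : continuous (fun x : V => w + x).
  by move=> x; apply: continuousD; [exact: cst_continuous|exact: cvg_id].
split=> x.
- by apply: continuous_comp; [exact: cw|exact: c1].
- by apply: continuous_comp; [exact: cw|exact: c2].
- apply: is_derive_from_line.
  have := @is_derive_line R n phi (e i) (w + x) 0 (dphi (w + x)).
  rewrite scale0r add0r => /(_ (c3 _)).
  by under eq_fun do rewrite addrCA.
Qed.

Definition diffquot j (h : R) phi (x : V) : R := (phi (h *: e j + x) - phi x) / h.

Lemma C1_along_diffquot i j h phi dphi : C1_along i phi dphi ->
  C1_along i (diffquot j h phi) (diffquot j h dphi).
Proof.
move=> hphi; have hs := C1_along_shift (h *: e j) hphi.
apply: (C1_along_eq (C1_alongZ h^-1 (C1_alongD hs (C1_alongZ (-1) hphi)))) => x;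
  by rewrite /diffquot mulN1r mulrC.
Qed.

(* Bochner's formula tested against [psi].  As [u] is only C^2, the gradient is
   replaced by difference quotients, for which the vector field
   [psi * sum_j D_j u * D_j (d_i u)] is C^1, before passing to the limit. *)
Lemma null_bochner (z : V) (L : nat) u (p dg : 'I_n -> V -> R)
    (H : 'I_n -> 'I_n -> V -> R) g psi (dpsi : 'I_n -> V -> R) :
  (forall i, C1_along i u (p i)) ->
  (forall i j, C1_along j (p i) (H i j)) ->
  (forall x, g x = \sum_i H i i x) ->
  (forall j, C1_along j g (dg j)) ->
  'I_n -> (forall i, C1_along i psi (dpsi i)) ->
  (forall x : V, (exists j, L%:R <= `|x 0 j - z 0 j|) -> psi x = 0) ->
  null z L (fun x => \sum_i dpsi i x * (\sum_j p j x * H i j x)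
     + psi x * (\sum_i \sum_j H i j x * H i j x + \sum_j p j x * dg j x)).
Proof.
move=> up pH gH gdg i0 hpsi psi0; have [cpsi _ _] := hpsi i0.
have cont' i phi dphi : C1_along i phi dphi -> continuous dphi by case.
have ulim i phi dphi : C1_along i phi dphi ->
    unif_lim z L (fun h => diffquot i h phi) dphi.
  by move=> h; split; [exact: cont' h|exact: unif_diffquot].
pose F i h x := dpsi i x * (\sum_j diffquot j h u x * diffquot j h (p i) x) +
  psi x * \sum_j (diffquot j h u x * diffquot j h (H i i) x
                 + diffquot j h (p i) x * diffquot j h (p i) x).
have FN i h : null z L (F i h).
  apply: (@null_partial _ _ z L i
    (fun x => psi x * \sum_j diffquot j h u x * diffquot j h (p i) x)); last first.
    by move=> x /psi0 ->; rewrite mul0r.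
  have hs : C1_along i (fun x => \sum_j diffquot j h u x * diffquot j h (p i) x)
      (fun x => \sum_j (diffquot j h u x * diffquot j h (H i i) x +
                 diffquot j h (p i) x * diffquot j h (p i) x)).
    by apply: C1_along_sum => j; apply: C1_alongM; exact: C1_along_diffquot.
  by apply: (C1_along_eq (C1_alongM (hpsi i) hs)) => // x; rewrite /F addrC [X in X + _]mulrC.
pose G h x := \sum_i dpsi i x * (\sum_j diffquot j h u x * diffquot j h (p i) x)
  + psi x * (\sum_i \sum_j diffquot j h (p i) x * diffquot j h (p i) x
             + \sum_j diffquot j h u x * diffquot j h g x).
(* Summed over [i], the quotients of the [H i i] combine into the quotient of the Laplacian [g],
   which is differentiable by hypothesis; third derivatives of [u] never appear. *)
have FG h x : \sum_i F i h x = G h x.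
  rewrite /F /G big_split /= -mulr_sumr; congr (_ + _ * _).
  under [LHS]eq_bigr => i _ do rewrite big_split /=.
  rewrite big_split addrC /=; congr (_ + _); rewrite exchange_big /=.
  apply: eq_bigr => j _; rewrite -mulr_sumr; congr (_ * _).
  by rewrite /diffquot -mulr_suml sumrB -!gH.
have GN h : null z L (G h).
  by apply: (null_eq (null_sum (fun i => FN i h))) => x; exact: FG.
have [_ hG] : unif_lim z L G (fun x => \sum_i dpsi i x * (\sum_j p j x * H i j x)
     + psi x * (\sum_i \sum_j H i j x * H i j x + \sum_j p j x * dg j x)).
  apply: unif_limD.
    apply: unif_lim_sum => i; apply: unif_limM.
      by apply: unif_lim_cst; exact: cont' (hpsi i).
    by apply: unif_lim_sum => j; apply: unif_limM; exact: ulim.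
  apply: unif_limM.
    exact: unif_lim_cst.
  apply: unif_limD.
    by apply: unif_lim_sum => i; apply: unif_lim_sum => j; apply: unif_limM; exact: ulim.
  by apply: unif_lim_sum => j; apply: unif_limM; exact: ulim.
apply: null_approx => eps e0; have [d d0 hd] := hG _ e0.
exists (G (d / 2)); first exact: GN.
move=> x bx; rewrite distrC; apply: hd => //.
by rewrite divr_gt0//= ltr_pdivrMr// ltr_pMr// ltr1n.
Qed.

End SecondOrder.

(** * Cutoff functions *)

Section Cutoff.
Context {R : realType} {n : nat}.
Local Notation V := 'rV[R]_n.
Local Notation e i := (delta_mx 0 i : V).

Lemma is_derive_pospart_exp (m : nat) (t : R) :
  is_derive t 1 (fun s : R => Num.max 0 s ^+ m.+2)
    (m.+2%:R * Num.max 0 t ^+ m.+1).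
Proof.
have [t0|] := ltP t 0; last rewrite le_eqVlt => /predU1P[<-|t0].
- have near0 : {near t, (fun=> 0) =1 (fun s : R => Num.max 0 s ^+ m.+2)}.
    near=> s; rewrite /= max_l ?expr0n//.
    by near: s; apply: filterS (lt_nbhsl t0) => s /ltW.
  rewrite expr0n mulr0.
  exact: (near_eq_is_derive near0).
- rewrite expr0n mulr0.
  have lim0 : (fun h : R => h^-1 *: (((fun s : R => Num.max 0 s ^+ m.+2) \o shift 0) (h *: (1 : R))
      - Num.max 0 0 ^+ m.+2)) h @[h --> 0^'] --> (0 : R).
    rewrite maxxx expr0n /=.
    apply/cvgr0Pnorm_le => eps eps0; near=> h.
    have h0 : h != 0 by near: h; exact: nbhs_dnbhs_neq.
    have h1 : `|h| <= Num.min 1 eps.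
      near: h; apply: nbhs_dnbhs; apply/nbhs_ballP; exists (Num.min 1 eps) => /=.
        by rewrite lt_min ltr01.
      by move=> y; rewrite /ball /= sub0r normrN => /ltW.
    move: h1; rewrite le_min => /andP[h1 h2].
    rewrite subr0 addr0 [_%:A]mulr1 normrM normfV normrX ler_pdivrMl ?normr_gt0//.
    have hm : `|Num.max 0 h| <= `|h|.
      by rewrite ger0_norm ?le_max ?lexx// ge_max normr_ge0 ler_norm.
    apply: (@le_trans _ _ (`|h| ^+ m.+2)); first by rewrite lerXn2r ?nnegrE.
    rewrite exprS ler_wpM2l// (le_trans _ h2)// exprS ler_piMr//.
    by rewrite exprn_ile1.
  split; first by apply/cvg_ex; exists 0.
  by apply: cvg_lim.
- have near0 : {near t, (fun s => s ^+ m.+2) =1 (fun s : R => Num.max 0 s ^+ m.+2)}.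
    near=> s; rewrite /= max_r//.
    by near: s; exact: lt_le_nbhsr.
  apply: (near_eq_is_derive near0).
  have := @is_deriveX R R id m.+2 t 1 1 (is_derive_id _ _).
  by rewrite /= [_ *: _]mulr1 exprfctE.
Unshelve. all: by end_near.
Qed.

Variables (z : V) (L : nat).

Definition sqcut (x : V) : R := 1 - (\sum_i (x 0 i - z 0 i) ^+ 2) / L%:R ^+ 2.
Definition cutoff (x : V) : R := Num.max 0 (sqcut x).
(** The gradient of the paraboloid [sqcut], not of its positive part: it does not vanish outside the
    ball, and is always used with a positive power of [cutoff] in front. *)
Definition dcut (i : 'I_n) (x : V) : R := - (2 * (x 0 i - z 0 i) / L%:R ^+ 2).

Lemma C1_along_coord (i j : 'I_n) : C1_along i (fun x : V => x 0 j) (fun=> (j == i)%:R).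
Proof.
split; [exact: coord_continuous|exact: cst_continuous|move=> x].
apply: is_derive_from_line.
have -> : (fun s : R => (s *: e i + x) 0 j) = (fun s => s * (j == i)%:R + x 0 j).
  by apply/funext => s; rewrite !mxE eqxx.
have h := @is_deriveD R R R (fun s : R => s * (j == i)%:R) (fun=> x 0 j) 0 1 (j == i)%:R 0 _ _.
rewrite -[X in is_derive _ _ _ X]addr0; apply: h.
have := @is_deriveM R R id (fun=> (j == i)%:R) 0 1 1 0 (is_derive_id _ _) (is_derive_cst _ _ _).
by rewrite /= scaler0 add0r [_ *: _]mulr1.
Qed.

Lemma C1_along_sqcut i : C1_along i sqcut (dcut i).
Proof.
have h j : C1_along i (fun x : V => (x 0 j - z 0 j) ^+ 2)
    (fun x => 2 * (x 0 j - z 0 j) * (j == i)%:R).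
  have hj := C1_alongD (C1_along_coord i j) (C1_along_cst i (- z 0 j)).
  by apply: (C1_along_eq (C1_alongM hj hj)) => x; ring.
apply: (C1_along_eq (C1_alongD (C1_along_cst i 1)
  (C1_alongZ (- (L%:R ^+ 2)^-1) (C1_along_sum h)))) => x.
  by rewrite /sqcut mulNr mulrC.
rewrite /dcut add0r (bigD1 i)//= eqxx mulr1 big1 ?addr0; first by ring.
by move=> j /negPf ->; rewrite mulr0.
Qed.

Lemma C1_along_cutoff i m : C1_along i (fun x => cutoff x ^+ m.+2)
  (fun x => m.+2%:R * cutoff x ^+ m.+1 * dcut i x).
Proof.
apply: (C1_along_comp (g := fun s : R => Num.max 0 s ^+ m.+2)
   (dg := fun s : R => m.+2%:R * Num.max 0 s ^+ m.+1) _ _ (C1_along_sqcut i)).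
  by move=> x; exact: is_derive_pospart_exp.
move=> x; have cm : continuous (fun s : R => Num.max 0 s).
  move=> s; apply: (@continuous_max _ _ (fun=> 0) id); [exact: cvg_cst|exact: cvg_id].
apply: cvgM; first exact: cvg_cst.
apply: (@continuous_comp _ _ _ (fun s : R => Num.max 0 s) (fun y => y ^+ m.+1)).
  exact: cm.
exact: exprn_continuous.
Qed.

Hypothesis L_gt0 : (0 < L)%N.

Lemma cutoff_ge0 x : 0 <= cutoff x.
Proof. by rewrite /cutoff le_max lexx. Qed.

Lemma cutoff_le1 x : cutoff x <= 1.
Proof.
rewrite /cutoff ge_max ler01 /= /sqcut lerBlDr lerDl divr_ge0 ?exprn_ge0//.
by apply: sumr_ge0 => i _; exact: sqr_ge0.
Qed.

Lemma cutoff_out (x : V) : (exists j, L%:R <= `|x 0 j - z 0 j|) -> cutoff x = 0.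
Proof.
move=> [j hj]; rewrite /cutoff max_l// /sqcut subr_le0 ler_pdivlMr ?exprn_gt0 ?ltr0n//.
rewrite mul1r (bigD1 j)//= -[leLHS]addr0; apply: lerD.
  by rewrite -[leRHS]real_normK ?num_real// lerXn2r ?nnegrE.
by apply: sumr_ge0 => i _; exact: sqr_ge0.
Qed.

(** [|D sqcut|^2] equals [4 / L^2 (1 - sqcut)], which is at most [4 / L^2] only where [sqcut >= 0];
    elsewhere the power of [cutoff] kills both sides. *)
Lemma sum_dcut_sqr_le m x : cutoff x ^+ m.+1 * \sum_i dcut i x ^+ 2 <=
  4 / L%:R ^+ 2 * cutoff x ^+ m.+1.
Proof.
have L0 : 0 < L%:R ^+ 2 :> R by rewrite exprn_gt0// ltr0n.
have -> : \sum_i dcut i x ^+ 2 = 4 / L%:R ^+ 2 * (1 - sqcut x).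
  rewrite /sqcut opprB addrCA subrr addr0 mulr_suml mulr_sumr.
  by apply: eq_bigr => i _; rewrite /dcut; field; rewrite gt_eqF ?ltr0n.
rewrite mulrCA ler_wpM2l ?divr_ge0 ?(ltW L0)//.
rewrite /cutoff; have [s0|s0] := leP (sqcut x) 0.
  by rewrite expr0n /= mul0r.
by rewrite ler_piMr ?exprn_ge0 ?(ltW s0)//; lra.
Qed.

End Cutoff.

(** * Pointwise algebra *)

Section TensorAlgebra.
Context {R : realType} {n : nat}.
Implicit Types (p q : 'I_n -> R) (H : 'I_n -> 'I_n -> R).

(** Lagrange's identity expresses the difference as half of a double sum of squares. *)
Lemma cauchy_schwarz p q :
  (\sum_i q i * p i) ^+ 2 <= (\sum_i q i ^+ 2) * (\sum_i p i ^+ 2).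
Proof.
have h : 0 <= \sum_i \sum_j (q i * p j - q j * p i) ^+ 2.
  by apply: sumr_ge0 => i _; apply: sumr_ge0 => j _; exact: sqr_ge0.
rewrite -subr_ge0; suff E : \sum_i \sum_j (q i * p j - q j * p i) ^+ 2 =
  2 * ((\sum_i q i ^+ 2) * (\sum_i p i ^+ 2) - (\sum_i q i * p i) ^+ 2).
  by move: h; rewrite E pmulr_rge0.
have E1 i : \sum_j (q i * p j - q j * p i) ^+ 2 =
  q i ^+ 2 * (\sum_j p j ^+ 2) + (p i ^+ 2 * (\sum_j q j ^+ 2)
   + (q i * p i) * (- 2 * (\sum_j q j * p j))).
  rewrite mulrA [_ * -2]mulrC !mulr_sumr -!big_split /=.
  by apply: eq_bigr => j _; ring.
rewrite (eq_bigr _ (fun i _ => E1 i)) !big_split /= -!mulr_suml; ring.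
Qed.

Let delta (i j : 'I_n) : R := (i == j)%:R.

Lemma sum_delta i (F : 'I_n -> R) : \sum_j delta i j * F j = F i.
Proof.
rewrite (bigD1 i)//= /delta eqxx mul1r big1 ?addr0// => j.
by rewrite eq_sym => /negPf ->; rewrite mul0r.
Qed.

Lemma sum_sqr_shifted H p (l m : R) :
  \sum_i \sum_j (H i j + l * (p i * p j) - m * delta i j) ^+ 2 =
  \sum_i \sum_j H i j * H i j + l ^+ 2 * (\sum_i p i ^+ 2) ^+ 2 + n%:R * m ^+ 2
  + 2 * l * (\sum_i (\sum_j p j * H i j) * p i) - 2 * m * (\sum_i H i i)
  - 2 * l * m * (\sum_i p i ^+ 2).
Proof.
have E1 i : \sum_j (H i j + l * (p i * p j) - m * delta i j) ^+ 2 =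
  \sum_j H i j * H i j + (p i ^+ 2 * (l ^+ 2 * \sum_j p j ^+ 2) + (m ^+ 2 +
  ((\sum_j p j * H i j) * p i * (2 * l) + (H i i * (- 2 * m) +
   (p i ^+ 2 * (- 2 * l * m)))))).
  have -> : p i ^+ 2 * (- 2 * l * m) = \sum_j delta i j * (p i * p j * (- 2 * l * m)).
    by rewrite sum_delta expr2.
  have -> : H i i * (- 2 * m) = \sum_j delta i j * (H i j * (-2 * m)).
    by rewrite sum_delta.
  have -> : m ^+ 2 = \sum_j delta i j * m ^+ 2 by rewrite sum_delta.
  rewrite [in RHS]mulrA -[_ * p i * _]mulrA !mulr_sumr !mulr_suml -!big_split /=.
  apply: eq_bigr => j _; have : delta i j * delta i j = delta i j.
    by rewrite /delta; case: eqP; rewrite ?mulr1 ?mulr0.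
  move: (delta i j) => d dd.
  have -> : (H i j + l * (p i * p j) - m * d) ^+ 2 =
    (H i j + l * (p i * p j)) ^+ 2 - 2 * m * d * (H i j + l * (p i * p j)) + (d * d) * m ^+ 2 by ring.
  by rewrite dd; ring.
rewrite (eq_bigr _ (fun i _ => E1 i)) !big_split /= -!mulr_suml sumr_const card_ord.
rewrite -[_ *+ n]mulr_natl; ring.
Qed.

Lemma sum_bilin_shifted H p q (l m : R) :
  \sum_i \sum_j q i * (H i j + l * (p i * p j) - m * delta i j) * p j =
  \sum_i q i * (\sum_j p j * H i j) + l * (\sum_i p i ^+ 2) * (\sum_i q i * p i)
  - m * (\sum_i q i * p i).
Proof.
have E1 i : \sum_j q i * (H i j + l * (p i * p j) - m * delta i j) * p j =
  q i * (\sum_j p j * H i j) + (q i * p i * (l * (\sum_j p j ^+ 2)) + q i * p i * (- m)).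
  have -> : q i * p i * - m = \sum_j delta i j * (q i * p j * - m) by rewrite sum_delta.
  by rewrite !mulr_sumr -!big_split /=; apply: eq_bigr => j _; ring.
rewrite (eq_bigr _ (fun i _ => E1 i)) !big_split /= -!mulr_suml; ring.
Qed.

(** The squared norm of the matrix [r E + m (q (x) p)], expanded. It plays the part of Young's
    inequality for the cutoff term of the tensor identity. *)
Lemma sum_sqr_outer_add (E : 'I_n -> 'I_n -> R) p q (r m : R) :
  0 <= r ^+ 2 * (\sum_i \sum_j E i j ^+ 2) +
     2 * m * r * (\sum_i \sum_j q i * E i j * p j) +
     m ^+ 2 * (\sum_i q i ^+ 2) * (\sum_i p i ^+ 2).
Proof.
suff <- : \sum_i \sum_j (r * E i j + m * (q i * p j)) ^+ 2 =
   r ^+ 2 * (\sum_i \sum_j E i j ^+ 2) +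
     2 * m * r * (\sum_i \sum_j q i * E i j * p j) +
     m ^+ 2 * (\sum_i q i ^+ 2) * (\sum_i p i ^+ 2).
  by apply: sumr_ge0 => i _; apply: sumr_ge0 => j _; exact: sqr_ge0.
have E1 i : \sum_j (r * E i j + m * (q i * p j)) ^+ 2 =
  r ^+ 2 * (\sum_j E i j ^+ 2) + (2 * m * r * (\sum_j q i * E i j * p j) +
   q i ^+ 2 * (m ^+ 2 * (\sum_j p j ^+ 2))).
  by rewrite !mulr_sumr -!big_split /=; apply: eq_bigr => j _; ring.
rewrite (eq_bigr _ (fun i _ => E1 i)) !big_split /= -!mulr_suml -!mulr_sumr; ring.
Qed.

End TensorAlgebra.

(** * Pointwise inequalities between the integrands *)

Section ScalarEstimates.
Context {R : realType}.
Implicit Types r rk w u f df P EE X qq m l : R.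

(** Here and in the next two lemmas [r] is the cutoff, [rk] a power of it, [l] is [L^2], and [w] is
    the weight with one power of [u] removed; [pc] stands for the critical exponent. The difference
    of the two sides is a combination, with nonnegative coefficients, of the square, the cutoff
    bound and the condition on [f]. *)
Lemma tracefree_scalar r rk w u f df P EE X qq m l pc nn beta :
  0 <= r -> 0 <= rk -> 0 <= w -> 0 < u -> 0 < l -> 0 <= nn -> 0 <= P ->
  0 <= r ^+ 2 * EE + 2 * m * r * X + m ^+ 2 * qq * P ->
  rk * qq <= 4 / l * rk -> 0 <= beta * f - u * df ->
  2^-1 * (rk * r ^+ 2 * (w * u) * EE) + nn * (pc - beta) * (rk * r ^+ 2 * w * f * P)
  <= w * u * (rk * r ^+ 2 * (EE + nn * (pc * f / u - df) * P) + m * (rk * r) * X)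
     + 2 * m ^+ 2 / l * (rk * (w * u) * P).
Proof.
move=> r0 rk0 w0 u0 l0 n0 P0 h1 h2 h3; rewrite -subr_ge0.
have -> : w * u * (rk * r ^+ 2 * (EE + nn * (pc * f / u - df) * P) + m * (rk * r) * X)
     + 2 * m ^+ 2 / l * (rk * (w * u) * P)
  - (2^-1 * (rk * r ^+ 2 * (w * u) * EE) + nn * (pc - beta) * (rk * r ^+ 2 * w * f * P))
  = 2^-1 * (w * u) * rk * (r ^+ 2 * EE + 2 * m * r * X + m ^+ 2 * qq * P)
  + (2^-1 * (w * u) * P * m ^+ 2 * (4 / l * rk - rk * qq)
  + w * (rk * r ^+ 2) * nn * P * (beta * f - u * df)).
  by field; rewrite !gt_eqF.
have wu : 0 <= w * u by rewrite mulr_ge0// ltW.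
have m2 : 0 <= m ^+ 2 by exact: sqr_ge0.
have r2 : 0 <= r ^+ 2 by exact: sqr_ge0.
have d : 0 <= 4 / l * rk - rk * qq by rewrite subr_ge0.
move: (4 / l * rk - _) d (r ^+ 2 * EE + _ + _) h1 (_ - u * df) h3 => D1 d1 D2 d2 D3 d3.
move: (m ^+ 2) m2 (r ^+ 2) r2 => M m2 r' r2; have u0' := ltW u0.
by rewrite !(addr_ge0, mulr_ge0).
Qed.

(** The difference is the square of [r f - m Q] plus multiples of the Cauchy-Schwarz, cutoff and [f]
    inequalities. *)
Lemma source_scalar r rk w u f df P Q qq m l b beta :
  0 <= r -> 0 <= rk -> 0 <= w -> 0 < u -> 0 <= P ->
  Q ^+ 2 <= qq * P -> rk * qq <= 4 / l * rk -> 0 <= beta * f - u * df ->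
  rk * r ^+ 2 * (w * u) * f ^+ 2 <=
  -2 * (m * (rk * r) * (f * (w * u)) * Q + rk * r ^+ 2 *
     ((f * (b * w) + w * u * df) * P - f * (w * u) * f))
  + 4 * m ^+ 2 / l * (rk * (w * u) * P)
  + 2 * (beta + b) * (rk * r ^+ 2 * w * f * P).
Proof.
move=> r0 rk0 w0 u0 P0 h1 h2 h3; rewrite -subr_ge0.
have -> : -2 * (m * (rk * r) * (f * (w * u)) * Q + rk * r ^+ 2 *
     ((f * (b * w) + w * u * df) * P - f * (w * u) * f))
  + 4 * m ^+ 2 / l * (rk * (w * u) * P)
  + 2 * (beta + b) * (rk * r ^+ 2 * w * f * P) - rk * r ^+ 2 * (w * u) * f ^+ 2
  = (w * u) * rk * (r * f - m * Q) ^+ 2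
  + ((w * u) * rk * m ^+ 2 * (qq * P - Q ^+ 2)
  + (w * u * m ^+ 2 * P * (4 / l * rk - rk * qq)
  + 2 * w * (rk * r ^+ 2) * P * (beta * f - u * df))) by ring.
have wu : 0 <= w * u by rewrite mulr_ge0// ltW.
have m2 : 0 <= m ^+ 2 by exact: sqr_ge0.
have r2 : 0 <= r ^+ 2 by exact: sqr_ge0.
have d : 0 <= 4 / l * rk - rk * qq by rewrite subr_ge0.
have d' : 0 <= qq * P - Q ^+ 2 by rewrite subr_ge0.
have d2 : 0 <= (r * f - m * Q) ^+ 2 by exact: sqr_ge0.
move: (4 / l * rk - _) d (qq * P - _) d' (_ ^+ 2) d2 (_ - u * df) h3 => D1 d1 D2 d2 D3 d3 D4 d4.
move: (m ^+ 2) m2 (r ^+ 2) r2 => M m2 r' r2; have u0' := ltW u0.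
by rewrite !(addr_ge0, mulr_ge0).
Qed.

(** The nonnegative quadratic form is the squared norm of [r p + (m / e) u q]. *)
Lemma gradient_scalar r rk w u f P Q qq m l e :
  e != 0 -> 0 <= r -> 0 <= rk -> 0 <= w -> 0 < u -> 0 < l ->
  0 <= r ^+ 2 * P + 2 * r * (m / e * u) * Q + (m / e * u) ^+ 2 * qq ->
  rk * qq <= 4 / l * rk ->
  rk * r ^+ 2 * w * P <=
  2 / e * (m * (rk * r) * (w * u) * Q + rk * r ^+ 2 * (e * w * P - w * u * f))
  + 4 * m ^+ 2 / (e ^+ 2 * l) * (rk * (w * u * u))
  + 2 / e * (rk * r ^+ 2 * (w * u) * f).
Proof.
move=> e0 r0 rk0 w0 u0 l0 h1 h2; rewrite -subr_ge0.
have -> : 2 / e * (m * (rk * r) * (w * u) * Q + rk * r ^+ 2 * (e * w * P - w * u * f))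
  + 4 * m ^+ 2 / (e ^+ 2 * l) * (rk * (w * u * u))
  + 2 / e * (rk * r ^+ 2 * (w * u) * f) - rk * r ^+ 2 * w * P
  = w * rk * (r ^+ 2 * P + 2 * r * (m / e * u) * Q + (m / e * u) ^+ 2 * qq)
  + w * (m / e * u) ^+ 2 * (4 / l * rk - rk * qq).
  by field; rewrite e0 gt_eqF.
have m2 : 0 <= (m / e * u) ^+ 2 by exact: sqr_ge0.
have d : 0 <= 4 / l * rk - rk * qq by rewrite subr_ge0.
move: (4 / l * rk - _) d (r ^+ 2 * P + _ + _) h1 => D1 d1 D2 d2.
move: ((m / e * u) ^+ 2) m2 => M m2.
by rewrite !(addr_ge0, mulr_ge0).
Qed.

Lemma sum_sqr_lin_ge0 (n : nat) (p q : 'I_n -> R) (r s : R) :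
  0 <= r ^+ 2 * (\sum_i p i ^+ 2) + 2 * r * s * (\sum_i q i * p i)
       + s ^+ 2 * (\sum_i q i ^+ 2).
Proof.
suff <- : \sum_i (r * p i + s * q i) ^+ 2 = r ^+ 2 * (\sum_i p i ^+ 2)
     + 2 * r * s * (\sum_i q i * p i) + s ^+ 2 * (\sum_i q i ^+ 2).
  by apply: sumr_ge0 => i _; exact: sqr_ge0.
by rewrite !mulr_sumr -!big_split; apply: eq_bigr => i _ /=; ring.
Qed.

End ScalarEstimates.

(** * Integral estimates *)

Section IntegralIdentities.
Context {R : realType} {n : nat}.
Local Notation V := 'rV[R]_n.
Local Notation e i := (delta_mx 0 i : V).
Variables (u : V -> R) (p : 'I_n -> V -> R) (H : 'I_n -> 'I_n -> V -> R).
Variables (f df : R -> R) (z : V) (L : nat).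
Hypothesis u_grad : forall i, C1_along i u (p i).
Hypothesis u_hess : forall i j, C1_along j (p i) (H i j).
Hypothesis u_gt0 : forall x, 0 < u x.
Hypothesis f_deriv : forall s : R, 0 < s -> is_derive s 1 f (df s).
Hypothesis df_cont : forall s : R, 0 < s -> {for s, continuous df}.
Hypothesis u_eq : forall x, \sum_i H i i x = - f (u x).
Hypothesis L_gt0 : (0 < L)%N.

Local Notation rho := (cutoff z L).
Local Notation q := (dcut z L).
Local Notation null := (null z L).

Definition grad2 x : R := \sum_i p i x ^+ 2.
Definition cutgrad x : R := \sum_i q i x * p i x.
Definition hess_grad_grad x : R := \sum_i (\sum_j p j x * H i j x) * p i x.

Local Notation P := grad2.
Local Notation Q := cutgrad.
Local Notation T := hess_grad_grad.

Section Weight.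
Variables (F dF : R -> R) (k : nat).
Hypothesis F_deriv : forall s : R, 0 < s -> is_derive s 1 F (dF s).
Hypothesis dF_cont : forall s : R, 0 < s -> {for s, continuous dF}.

Lemma C1_along_weight i : C1_along i (fun x => F (u x)) (fun x => dF (u x) * p i x).
Proof.
apply: (C1_along_comp _ _ (u_grad i)) => x; first exact: F_deriv.
exact: dF_cont.
Qed.

Let psi_C1 i : C1_along i (fun x => rho x ^+ k.+2 * F (u x))
  (fun x => rho x ^+ k.+2 * dF (u x) * p i x +
     F (u x) * (k.+2%:R * rho x ^+ k.+1) * q i x).
Proof.
apply: (C1_along_eq (C1_alongM (C1_along_cutoff z L i k) (C1_along_weight i))) => // x.
by rewrite !mulrA.
Qed.

Let psi0 (x : V) : (exists j, L%:R <= `|x 0 j - z 0 j|) -> rho x ^+ k.+2 * F (u x) = 0.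
Proof. by move=> h; rewrite cutoff_out// expr0n mul0r. Qed.

(** The divergence of [rho^(k+2) F(u) Du], with the equation substituted for the Laplacian. *)
Lemma null_flux : null (fun x => k.+2%:R * rho x ^+ k.+1 * F (u x) * Q x +
  rho x ^+ k.+2 * (dF (u x) * P x - F (u x) * f (u x))).
Proof.
have h i : null (fun x => rho x ^+ k.+2 * F (u x) * H i i x + p i x *
   (rho x ^+ k.+2 * dF (u x) * p i x + F (u x) * (k.+2%:R * rho x ^+ k.+1) * q i x)).
  apply: (null_partial (C1_alongM (psi_C1 i) (u_hess i i))) => x /psi0 ->.
  by rewrite mul0r.
apply: (null_eq (null_sum h)) => x; rewrite big_split /= -mulr_sumr u_eq.
rewrite /Q /P /cutgrad /grad2.
have -> : \sum_i p i x * (rho x ^+ k.+2 * dF (u x) * p i x +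
    F (u x) * (k.+2%:R * rho x ^+ k.+1) * q i x) =
  rho x ^+ k.+2 * dF (u x) * (\sum_i p i x ^+ 2) +
  F (u x) * (k.+2%:R * rho x ^+ k.+1) * (\sum_i q i x * p i x).
  by rewrite !mulr_sumr -big_split; apply: eq_bigr => i _ /=; ring.
ring.
Qed.

(** The divergence of [rho^(k+2) F(u) |Du|^2 Du], a C^1 field since it involves only first
    derivatives of [u]. *)
Lemma null_flux_grad2 : null (fun x =>
  k.+2%:R * rho x ^+ k.+1 * F (u x) * P x * Q x +
  rho x ^+ k.+2 * (dF (u x) * P x ^+ 2 + 2 * F (u x) * T x - F (u x) * P x * f (u x))).
Proof.
have PC1 i : C1_along i P (fun x => 2 * \sum_j p j x * H j i x).
  apply: (C1_along_eq (C1_along_sum (fun j => C1_alongM (u_hess j i) (u_hess j i)))) => x.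
    by rewrite /P /grad2; apply: eq_bigr => j _; rewrite expr2.
  by rewrite mulr_sumr; apply: eq_bigr => j _; ring.
have h i : null (fun x => rho x ^+ k.+2 * F (u x) * (P x * H i i x + p i x *
    (2 * \sum_j p j x * H j i x)) + P x * p i x *
   (rho x ^+ k.+2 * dF (u x) * p i x + F (u x) * (k.+2%:R * rho x ^+ k.+1) * q i x)).
  apply: (null_partial (C1_alongM (psi_C1 i) (C1_alongM (PC1 i) (u_hess i i)))).
  by move=> x /psi0 ->; rewrite mul0r.
apply: (null_eq (null_sum h)) => x.
have -> : T x = \sum_i p i x * \sum_j p j x * H j i x.
  rewrite /T /hess_grad_grad; under eq_bigr do rewrite mulr_suml.
  rewrite exchange_big; apply: eq_bigr => i _ /=; rewrite mulr_sumr.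
  by apply: eq_bigr => j _; ring.
transitivity (rho x ^+ k.+2 * F (u x) * P x * (\sum_i H i i x)
    + (2 * rho x ^+ k.+2 * F (u x) * (\sum_i p i x * \sum_j p j x * H j i x)
    + (P x * rho x ^+ k.+2 * dF (u x) * (\sum_i p i x ^+ 2) +
       P x * F (u x) * (k.+2%:R * rho x ^+ k.+1) * (\sum_i q i x * p i x)))).
  have -> (S : 'I_n -> R) (Px : R) : rho x ^+ k.+2 * F (u x) * Px * (\sum_i H i i x)
    + (2 * rho x ^+ k.+2 * F (u x) * (\sum_i p i x * S i)
    + (Px * rho x ^+ k.+2 * dF (u x) * (\sum_i p i x ^+ 2) +
       Px * F (u x) * (k.+2%:R * rho x ^+ k.+1) * (\sum_i q i x * p i x))) =
    \sum_i (rho x ^+ k.+2 * F (u x) * (Px * H i i x + p i x * (2 * S i)) +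
    Px * p i x * (rho x ^+ k.+2 * dF (u x) * p i x +
       F (u x) * (k.+2%:R * rho x ^+ k.+1) * q i x)); last by [].
  by rewrite !mulr_sumr -!big_split; apply: eq_bigr => i _ /=; ring.
rewrite u_eq -/(P x) -/(Q x); ring.
Qed.

Lemma null_bochner_cutoff (i0 : 'I_n) : null (fun x =>
  k.+2%:R * rho x ^+ k.+1 * F (u x) * (\sum_i q i x * \sum_j p j x * H i j x) +
  rho x ^+ k.+2 * (dF (u x) * T x + F (u x) *
     (\sum_i \sum_j H i j x * H i j x - df (u x) * P x))).
Proof.
have gC1 i : C1_along i (fun x => -1 * f (u x)) (fun x => -1 * (df (u x) * p i x)).
  apply: C1_alongZ; apply: (C1_along_comp _ _ (u_grad i)) => x; first exact: f_deriv.
  exact: df_cont.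
have lapg x : -1 * f (u x) = \sum_i H i i x by rewrite u_eq mulN1r.
apply: (null_eq (null_bochner u_grad u_hess lapg gC1 i0 psi_C1 psi0)) => x.
have -> : \sum_i (rho x ^+ k.+2 * dF (u x) * p i x +
     F (u x) * (k.+2%:R * rho x ^+ k.+1) * q i x) * (\sum_j p j x * H i j x) =
  rho x ^+ k.+2 * dF (u x) * T x +
  F (u x) * (k.+2%:R * rho x ^+ k.+1) * (\sum_i q i x * \sum_j p j x * H i j x).
  rewrite /T /hess_grad_grad !mulr_sumr -big_split; apply: eq_bigr => i _ /=; ring.
have -> : \sum_j p j x * (-1 * (df (u x) * p j x)) = - df (u x) * P x.
  by rewrite /P /grad2 mulr_sumr; apply: eq_bigr => j _; ring.
ring.
Qed.

End Weight.

Hypothesis n_ge3 : (2 < n)%N.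

Local Notation a := (- 2 / (n%:R - 2) : R).
Local Notation c := (- n%:R / (n%:R - 2) : R).

(* The trace-free part of [D^2 u + c (Du (x) Du) / u]; for this value of [c] it
   is, up to a factor, the trace-free Hessian of [u ^ (- 2 / (n - 2))]. *)
Definition tracefree (i j : 'I_n) x : R :=
  H i j x + c / u x * (p i x * p j x)
  - (- f (u x) + c / u x * P x) / n%:R * (i == j)%:R.

Lemma is_derive_powR (b s : R) : 0 < s -> is_derive s 1 (fun t : R => t `^ b) (b * s `^ (b - 1)).
Proof. exact: is_derive1_powR. Qed.

Lemma is_derive_cont (g : R -> R) (s d : R) :
  is_derive s 1 g d -> {for s, continuous g}.
Proof. by case=> h _; apply: differentiable_continuous; apply/derivable1_diffP. Qed.

Lemma powR_cont (b s : R) : 0 < s -> {for s, continuous (fun t : R => b * t `^ (b - 1))}.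
Proof.
move=> s0; apply: cvgM; first exact: cvg_cst.
exact: (is_derive_cont (@is_derive_powR (b - 1) s s0)).
Qed.

Lemma is_derive_fpowR (b s : R) : 0 < s -> is_derive s 1 (fun t : R => f t * t `^ b)
   (f s * (b * s `^ (b - 1)) + s `^ b * df s).
Proof. by move=> s0; exact: (is_deriveM (f_deriv s0) (@is_derive_powR b s s0)). Qed.

Lemma fpowR_cont (b s : R) : 0 < s ->
  {for s, continuous (fun t : R => f t * (b * t `^ (b - 1)) + t `^ b * df t)}.
Proof.
move=> s0; apply: cvgD; apply: cvgM.
- exact: (is_derive_cont (f_deriv s0)).
- exact: powR_cont.
- exact: (is_derive_cont (@is_derive_powR b s s0)).
- exact: df_cont.
Qed.

Lemma powR_sub1 (b s : R) : 0 < s -> s `^ b = s `^ (b - 1) * s.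
Proof.
move=> s0; rewrite -[X in _ = _ * X](powRr1 (ltW s0)) -powRD ?subrK//.
by rewrite (gt_eqF s0) implybT.
Qed.

(** The field [u^a E p] is the sum of [u^a D^2u p], [1/n] times [u^a f(u) p], and [c (1 - 1/n)]
    times [u^(a-1) |p|^2 p], which gives the three identities and their coefficients. For the
    divergence to contain [|E|^2] exactly, the terms in [D^2u(p,p)] require [a = 2 c / n] and those
    in [|p|^4] require [a - 1 = c]; this determines both constants. *)
Lemma null_div_tracefree (k : nat) : null (fun x => u x `^ a *
  (rho x ^+ k.+2 * (\sum_i \sum_j tracefree i j x ^+ 2 +
     (1 - n%:R^-1) * ((n%:R + 2) / (n%:R - 2) * f (u x) / u x - df (u x)) * P x)
   + k.+2%:R * rho x ^+ k.+1 * \sum_i \sum_j q i x * tracefree i j x * p j x)).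
Proof.
have i0 : 'I_n by exact: Ordinal (ltn_trans (ltn0Sn 1) n_ge3).
have V1 := null_bochner_cutoff k (@is_derive_powR a) (@powR_cont a) i0.
have V2 := null_flux k (@is_derive_fpowR a) (@fpowR_cont a).
have V3 := null_flux_grad2 k (@is_derive_powR (a - 1)) (@powR_cont (a - 1)).
have n2 : n%:R - 2 != 0 :> R.
  by rewrite subr_eq0 eqr_nat; case: n n_ge3 => [|[|[|]]].
have n0 : n%:R != 0 :> R by rewrite pnatr_eq0; case: n n_ge3.
apply: (null_eq (nullD V1 (nullD (nullZ n%:R^-1 V2) (nullZ (c * (1 - n%:R^-1)) V3)))) => x.
rewrite sum_sqr_shifted sum_bilin_shifted u_eq -/(P x) -/(Q x) -/(T x).
rewrite !(powR_sub1 a (u_gt0 x)) !(powR_sub1 (a - 1) (u_gt0 x)) (exprS _ k.+1).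
have ux : u x != 0 by rewrite gt_eqF.
move: (\sum_i \sum_j H i j x * H i j x) (\sum_i q i x * _) => HH qT.
move: (_ `^ (_ - 1 - 1)) (P x) (Q x) (T x) (rho x ^+ k.+1) => w P Q T r.
move: (f (u x)) (df (u x)) (rho x) (k.+2%:R) => fx dfx rh kk.
move: (u x) ux => ux ux0; move: (n%:R) n0 n2 => nn n0 n2.
field.
by rewrite ux0 n0 n2.
Qed.

Variable beta : R.
Hypothesis f_beta : forall s, 0 < s -> 0 <= beta * f s - s * df s.

Local Notation kappa := ((1 - n%:R^-1) * ((n%:R + 2) / (n%:R - 2) - beta) : R).

Lemma tracefree_estimate (k : nat) : exists2 D, null D & forall x,
  2^-1 * (rho x ^+ k.+3 * u x `^ a * \sum_i \sum_j tracefree i j x ^+ 2) +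
  kappa * (rho x ^+ k.+3 * u x `^ (a - 1) * f (u x) * P x) <=
  D x + 2 * k.+3%:R ^+ 2 / L%:R ^+ 2 * (rho x ^+ k.+1 * u x `^ a * P x).
Proof.
eexists; first exact: (null_div_tracefree k.+1).
move=> x; have n0 : 0 <= 1 - n%:R^-1 :> R.
  by rewrite subr_ge0 invf_le1 ?ler1n ?ltr0n; case: n n_ge3.
have h1 := sum_sqr_outer_add (fun i j => tracefree i j x) (fun i => p i x)
  (fun i => q i x) (rho x) k.+3%:R.
have E3 : rho x ^+ k.+3 = rho x ^+ k.+1 * rho x ^+ 2 by rewrite -exprD addn2.
have E2 : rho x ^+ k.+2 = rho x ^+ k.+1 * rho x by rewrite exprSr.
cbv beta; rewrite E3 E2 (powR_sub1 a (u_gt0 x)).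
have l0 : 0 < L%:R ^+ 2 :> R by rewrite exprn_gt0// ltr0n.
have r0 := cutoff_ge0 z L x.
have rk0 : 0 <= rho x ^+ k.+1 by rewrite exprn_ge0.
have P0 : 0 <= P x by apply: sumr_ge0 => i _; exact: sqr_ge0.
have := tracefree_scalar ((n%:R + 2) / (n%:R - 2)) r0 rk0 (powR_ge0 (u x) (a - 1)) (u_gt0 x) l0
   n0 P0 h1 (sum_dcut_sqr_le z L_gt0 k x) (f_beta (u_gt0 x)).
by [].
Qed.

(** The equation tested with [u^b f(u)], the derivative of [f] being eliminated by [f_beta]. For
    [b = a] the last term is a multiple of one that [tracefree_estimate] controls. *)
Lemma source_estimate (b : R) (k : nat) : exists2 D, null D & forall x,
  rho x ^+ k.+3 * u x `^ b * f (u x) ^+ 2 <=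
  D x + 4 * k.+3%:R ^+ 2 / L%:R ^+ 2 * (rho x ^+ k.+1 * u x `^ b * P x) +
  2 * (beta + b) * (rho x ^+ k.+3 * u x `^ (b - 1) * f (u x) * P x).
Proof.
eexists; first exact: (nullZ (-2) (null_flux k.+1 (@is_derive_fpowR b) (@fpowR_cont b))).
move=> x.
have E3 : rho x ^+ k.+3 = rho x ^+ k.+1 * rho x ^+ 2 by rewrite -exprD addn2.
have E2 : rho x ^+ k.+2 = rho x ^+ k.+1 * rho x by rewrite exprSr.
cbv beta; rewrite E3 E2 (powR_sub1 b (u_gt0 x)).
apply: (source_scalar _ _ _ _ _ _ _ (cauchy_schwarz _ _) (sum_dcut_sqr_le z L_gt0 k x) (f_beta (u_gt0 x))) => //.
- exact: cutoff_ge0.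
- by rewrite exprn_ge0// cutoff_ge0.
- exact: powR_ge0.
- by apply: sumr_ge0 => i _; exact: sqr_ge0.
Qed.

(** The equation tested with [u^e]; for [e = 0] the flux contains no gradient term. If [e < 0] and
    [f >= 0], the source term has a favourable sign, which is superharmonicity at work. *)
Lemma gradient_estimate (e : R) (k : nat) : e != 0 -> exists2 D, null D & forall x,
  rho x ^+ k.+3 * u x `^ (e - 1) * P x <=
  D x + 4 * k.+3%:R ^+ 2 / (e ^+ 2 * L%:R ^+ 2) * (rho x ^+ k.+1 * u x `^ (e + 1))
  + 2 / e * (rho x ^+ k.+3 * u x `^ e * f (u x)).
Proof.
move=> e0; eexists.
  exact: (nullZ (2 / e) (null_flux k.+1 (@is_derive_powR e) (@powR_cont e))).
move=> x.
have E3 : rho x ^+ k.+3 = rho x ^+ k.+1 * rho x ^+ 2 by rewrite -exprD addn2.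
have E2 : rho x ^+ k.+2 = rho x ^+ k.+1 * rho x by rewrite exprSr.
cbv beta; rewrite E3 E2 (powR_sub1 (e + 1) (u_gt0 x)) addrK (powR_sub1 e (u_gt0 x)).
have l0 : 0 < L%:R ^+ 2 :> R by rewrite exprn_gt0// ltr0n.
have r0 := cutoff_ge0 z L x.
have rk0 : 0 <= rho x ^+ k.+1 by rewrite exprn_ge0.
have h1 := sum_sqr_lin_ge0 (fun i => p i x) (fun i => q i x) (rho x) (k.+3%:R / e * u x).
have := gradient_scalar (f (u x)) e0 r0 rk0 (powR_ge0 (u x) (e - 1)) (u_gt0 x) l0
   h1 (sum_dcut_sqr_le z L_gt0 k x).
by [].
Qed.

End IntegralIdentities.

(** * Vanishing of the trace-free tensor in dimension three *)

Section Liouville.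
Context {R : realType} {n : nat}.
Local Notation V := 'rV[R]_n.
Local Notation e i := (delta_mx 0 i : V).

Lemma C2_grad (u : V -> R) i : C2 u -> C1_along i u (partial i u).
Proof.
move=> [[cu hu] _]; have [du cdu] := hu i; by split=> // x; exact/derivableP.
Qed.

Lemma C2_hess (u : V -> R) i j :
  C2 u -> C1_along j (partial i u) (partial j (partial i u)).
Proof.
move=> [_ /(_ i)[cu hu]]; have [du cdu] := hu j; by split=> // x; exact/derivableP.
Qed.

Lemma C1_along_partial (u du : V -> R) i : C1_along i u du -> partial i u = du.
Proof. by move=> [_ _ h]; apply/funext => x; case: (h x). Qed.

Lemma null_cst0 (z : V) L : null z L (fun=> 0).
Proof.
apply: (@null_eq _ _ z L (fun=> \sum_(k : 'I_0) 0)); last by move=> x; rewrite big_ord0.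
by apply: null_sum => -[].
Qed.

Lemma continuous_add (F G : V -> R) :
  continuous F -> continuous G -> continuous (fun x => F x + G x).
Proof. by move=> cF cG x; exact: (cvgD (cF x) (cG x)). Qed.

Lemma continuous_mul (F G : V -> R) :
  continuous F -> continuous G -> continuous (fun x => F x * G x).
Proof. by move=> cF cG x; exact: (cvgM (cF x) (cG x)). Qed.

Lemma continuous_opp (F : V -> R) : continuous F -> continuous (fun x => - F x).
Proof. by move=> cF x; exact: (cvgN (cF x)). Qed.

Lemma continuous_bigsum (I : finType) (F : I -> V -> R) :
  (forall k, continuous (F k)) -> continuous (fun x => \sum_k F k x).
Proof.
move=> h; elim: (index_enum I) => [|k s ih].
  by under eq_fun do rewrite big_nil; exact: cst_continuous.
under eq_fun do rewrite big_cons.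
by move=> x; exact: (cvgD (h k x) (ih x)).
Qed.

(** If [B z > 0], then [B] is bounded below on a fixed cube of radius [r <= 1] around [z], and so is
    the cutoff: there [|x - z|^2 <= n], and [n < L] makes the cutoff at least 1/2. The resulting
    lower bound does not depend on [L]. *)
Lemma null_estimate_eq0 (z : V) (B : V -> R) (m : nat) :
  continuous B -> (forall x, 0 <= B x) ->
  (forall eps : R, 0 < eps -> exists L D K, [/\ (n < L)%N, null z L D, 0 <= K,
     K * (2 * L%:R + 1) ^+ n <= eps &
     forall x, cutoff z L x ^+ m * B x <= D x + K]) ->
  B z = 0.
Proof.
move=> cB B0 h; apply/eqP; rewrite eq_le B0 andbT leNgt; apply/negP => Bz.
have : \forall x \near z, B z / 2 < B x.
  by apply: (cvgr_gt _ (cB z)); rewrite ltr_pdivrMr// ltr_pMr// ltr1n.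
move=> /nbhs_ballP[d /= d0 hd].
pose r := Num.min 1 (d / 2).
have r0 : 0 < r by rewrite lt_min ltr01 divr_gt0.
have rd : r < d.
  by rewrite (@le_lt_trans _ _ (d / 2)) ?ge_min ?lexx ?orbT// ltr_pdivrMr// ltr_pMr// ltr1n.
have r1 : r <= 1 by rewrite ge_min lexx.
pose c := 2^-1 ^+ m * (B z / 2).
have c0 : 0 < c by rewrite mulr_gt0 ?exprn_gt0 ?divr_gt0.
have [L [D [K [nL nD K0 KL hB]]]] := h (c * r ^+ n / 2) ltac:(by rewrite divr_gt0// mulr_gt0// exprn_gt0).
have L1 : 1 <= L%:R :> R by rewrite ler1n (leq_trans _ nL).
have key : c * r ^+ n <= K * (2 * L%:R + 1) ^+ n.
  apply: (null_lower_bound (A := fun x => cutoff z L x ^+ m * B x) nD) => //.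
  - by move=> x _; rewrite mulr_ge0// exprn_ge0// cutoff_ge0.
  - exact: ltW.
  - by rewrite (ltW r0) (le_trans r1).
  move=> x xr; apply: ler_pM.
  - by rewrite exprn_ge0// invr_ge0.
  - by rewrite divr_ge0// ltW.
  - rewrite lerXn2r ?nnegrE ?invr_ge0 ?cutoff_ge0//.
    rewrite /cutoff le_max; apply/orP; right; rewrite /sqcut.
    have S1 : \sum_i (x 0 i - z 0 i) ^+ 2 <= n%:R.
      rewrite -[n in leRHS]card_ord -sumr_const; apply: ler_sum => i _.
      rewrite -[leLHS]real_normK ?num_real// exprn_ile1// (le_trans (xr i))//.
    have nL' : n%:R + 1 <= L%:R :> R by rewrite natr1 ler_nat.
    have : (\sum_i (x 0 i - z 0 i) ^+ 2) / L%:R ^+ 2 <= 2^-1.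
      rewrite ler_pdivrMr ?exprn_gt0 ?(lt_le_trans ltr01)//.
      have nn0 : 0 <= n%:R :> R by [].
      move: (\sum_i _) S1 nL' nn0 L1; move: (n%:R) (L%:R) => nn l S S1 nL' nn0 L1.
      have : 0 <= (l - nn - 1) * (l + nn + 1) by apply: mulr_ge0; lra.
      by nra.
    by move: (_ / _) => S hS; lra.
  apply/ltW/hd; split=> // i j; rewrite ord1 /ball /= distrC.
  by rewrite (le_lt_trans (xr j)).
have c1 : 0 < c * r ^+ n by rewrite mulr_gt0 ?exprn_gt0.
by have := le_trans key KL; rewrite ler_pdivlMr// leNgt ltr_pMr// ltr1n.
Qed.

Lemma continuous_powRu (u : V -> R) (b : R) : continuous u -> (forall x, 0 < u x) ->
  continuous (fun x => u x `^ b).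
Proof.
move=> cu u0 x; apply: (@continuous_comp _ _ _ u (fun t : R => t `^ b)).
  exact: cu.
have h := is_derive_powR b (u0 x).
exact: (is_derive_cont h).
Qed.

(* In dimension three [a = -2], so the right-hand side of [tracefree_estimate]
   is the energy of [ln u], which is bounded because [u] is superharmonic. *)
Lemma tracefree_eq0 (u : V -> R) (p : 'I_n -> V -> R) (H : 'I_n -> 'I_n -> V -> R)
    (f df : R -> R) (beta : R) :
  n = 3%N ->
  (forall i, C1_along i u (p i)) -> (forall i j, C1_along j (p i) (H i j)) ->
  (forall x, 0 < u x) ->
  (forall s : R, 0 < s -> is_derive s 1 f (df s)) ->
  (forall s : R, 0 < s -> {for s, continuous df}) ->
  (forall x, \sum_i H i i x = - f (u x)) ->
  beta < (n%:R + 2) / (n%:R - 2) ->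
  (forall s, 0 < s -> 0 <= beta * f s - s * df s) ->
  (forall x, 0 <= f (u x)) ->
  forall z, (forall i j, tracefree u p H f i j z = 0) /\ f (u z) * grad2 p z = 0.
Proof.
move=> n3 up pH u0 fd fc lap betan fbeta fu0 z.
have n_ge3 : (2 < n)%N by rewrite n3.
pose a : R := - 2 / (n%:R - 2).
have a2 : a = -2 by rewrite /a n3; field.
pose kappa : R := (1 - n%:R^-1) * ((n%:R + 2) / (n%:R - 2) - beta).
have k0 : 0 < kappa.
  rewrite mulr_gt0 ?subr_gt0//.
  by rewrite invf_lt1 ?ltr1n ?ltr0n n3.
pose EE x := \sum_i \sum_j tracefree u p H f i j x ^+ 2.
pose B x := u x `^ a * EE x / 2 + kappa * (u x `^ (a - 1) * f (u x) * grad2 p x).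
have i0 : 'I_n by rewrite n3; exact: ord0.
have cu : continuous u by case: (up i0).
have cp i : continuous (p i) by case: (up i).
have cH i j : continuous (H i j) by case: (pH i j).
have cP : continuous (grad2 p).
  by apply: continuous_bigsum => i x; exact: (cvgM (cp i x) (cp i x)).
have cf : continuous (fun x => f (u x)).
  by case: (C1_along_weight up u0 fd fc i0).
have cC (c : R) : continuous (fun _ : V => c) by exact: cst_continuous.
have cinv (c : R) : continuous (fun x => c / u x).
  apply: continuous_mul => // x.
  exact: (cvgV (lt0r_neq0 (u0 x)) (cu x)).
have cE i j : continuous (tracefree u p H f i j).
  apply: continuous_add; first apply: continuous_add => //.
    by apply: continuous_mul => //; exact: continuous_mul.
  apply: continuous_opp; apply: continuous_mul => //; apply: continuous_mul => //.
  by apply: continuous_add; [exact: continuous_opp|exact: continuous_mul].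
have cB : continuous B.
  apply: continuous_add.
    apply: continuous_mul => //; apply: continuous_mul; first exact: continuous_powRu.
    by do 2 apply: continuous_bigsum => ?; exact: continuous_mul.
  apply: continuous_mul => //; apply: continuous_mul => //.
  by apply: continuous_mul => //; exact: continuous_powRu.
have P0 x : 0 <= grad2 p x by apply: sumr_ge0 => i _; exact: sqr_ge0.
have EE0 x : 0 <= EE x.
  by apply: sumr_ge0 => i _; apply: sumr_ge0 => j _; exact: sqr_ge0.
have B1 x : 0 <= u x `^ a * EE x / 2 by rewrite !mulr_ge0 ?powR_ge0 ?invr_ge0.
have B2 x : 0 <= kappa * (u x `^ (a - 1) * f (u x) * grad2 p x).
  apply: mulr_ge0; first exact: ltW.
  by apply: mulr_ge0 => //; apply: mulr_ge0 => //; exact: powR_ge0.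
have Bz : B z = 0.
  (* Each of the two estimates used costs two powers of the cutoff: from 5 to 3, then from 3 to
     1. *)
  apply: (@null_estimate_eq0 z B 5 cB) => [x|eps eps0]; first by rewrite addr_ge0.
  (* The error is [50 / L^2 * 36 / L^2] and the volume at most [(3 L)^3]; their product is
     [48600 / L]. *)
  pose L := (3 + Num.truncn ((486 * 100) / eps)).+1.
  have nL : (n < L)%N by rewrite n3 /L ltnS leq_addr.
  have L0 : (0 < L)%N by [].
  have Lr : (486 * 100) / eps <= L%:R.
    apply: ltW; apply: (lt_le_trans (truncnS_gt _)).
    by rewrite /L ler_nat ltnS leq_addl.
  have L1 : 1 <= L%:R :> R by rewrite ler1n.
  have [D1 nD1 h1] := tracefree_estimate z up pH u0 fd fc lap L0 n_ge3 fbeta 2.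
  have N1 : -1 != 0 :> R by rewrite oppr_eq0 oner_neq0.
  have [D2 nD2 h2] := gradient_estimate z up pH u0 lap L0 0 N1.
  exists L, (fun x => D1 x + 50 / L%:R ^+ 2 * D2 x), (50 / L%:R ^+ 2 * (36 / L%:R ^+ 2)).
  split=> //.
  - exact: nullD nD1 (nullZ _ nD2).
  - rewrite n3; have l0 : 0 < L%:R :> R by rewrite (lt_le_trans ltr01).
    have : (486 * 100) <= L%:R * eps by rewrite -ler_pdivrMr.
    move: (L%:R) L1 l0 => l l1 l0 h.
    apply: (@le_trans _ _ (50 / l ^+ 2 * (36 / l ^+ 2) * (3 * l) ^+ 3)).
      have l20 : 0 <= l ^+ 2 by rewrite exprn_ge0// ltW.
      apply: ler_wpM2l; first by rewrite mulr_ge0// divr_ge0.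
      by apply: lerXn2r; rewrite ?nnegrE; lra.
    have -> : 50 / l ^+ 2 * (36 / l ^+ 2) * (3 * l) ^+ 3 = (486 * 100) / l.
      by field; rewrite gt_eqF.
    by rewrite ler_pdivrMr// [eps * l]mulrC.
  move=> x; have := h1 x; have := h2 x; rewrite -/a /B a2.
  have -> : -1 - 1 = -2 :> R by ring.
  rewrite addNr powRr0 sqrrN expr1n mul1r invrN1 mulrN1 expr1 mulr1 -/(EE x) -/kappa.
  have il0 : 0 <= (L%:R ^+ 2)^-1 :> R by rewrite invr_ge0 exprn_ge0.
  have Z0 : 0 <= cutoff z L x ^+ 3 * u x `^ (-1) * f (u x).
    by rewrite !mulr_ge0 ?exprn_ge0 ?cutoff_ge0 ?powR_ge0.
  have c1 := cutoff_le1 z L x.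
  have -> : cutoff z L x ^+ 5 * (u x `^ (-2) * EE x / 2 +
      kappa * (u x `^ (-2 - 1) * f (u x) * grad2 p x)) =
    2^-1 * (cutoff z L x ^+ 5 * u x `^ (-2) * EE x) +
    kappa * (cutoff z L x ^+ 5 * u x `^ (-2 - 1) * f (u x) * grad2 p x) by ring.
  move=> g1 g2; apply: (le_trans g2); rewrite -addrA lerD2l.
  have -> : 2 * 5 ^+ 2 = 50 :> R by ring.
  rewrite -mulrDr; apply: ler_wpM2l; first by rewrite mulr_ge0.
  apply: (le_trans g1); rewrite -addrA lerD2l.
  have -> : 4 * 3 ^+ 2 = 36 :> R by ring.
  have : 36 / L%:R ^+ 2 * cutoff z L x <= 36 / L%:R ^+ 2.
    by rewrite ler_piMr// mulr_ge0.
  lra.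
have Bz2 := B2 z; have Bz1 := B1 z.
have e1 : u z `^ a * EE z / 2 = 0 by apply/eqP; rewrite eq_le Bz1 andbT -Bz lerDl.
have e2 : kappa * (u z `^ (a - 1) * f (u z) * grad2 p z) = 0.
  by apply/eqP; rewrite eq_le Bz2 andbT -Bz lerDr.
split.
  have EEz : EE z = 0.
    move: e1 => /eqP; rewrite !mulf_eq0 gt_eqF ?powR_gt0//= invr_eq0 pnatr_eq0 orbF.
    by move/eqP.
  move=> i j.
  have h1 : \sum_j tracefree u p H f i j z ^+ 2 = 0.
    move: EEz => /eqP; rewrite psumr_eq0 => [/allP/(_ i)|k _]; last first.
      by apply: sumr_ge0 => l _; exact: sqr_ge0.
    by rewrite mem_index_enum => /(_ isT)/eqP.
  move: h1 => /eqP; rewrite psumr_eq0 => [/allP/(_ j)|k _]; last exact: sqr_ge0.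
  by rewrite mem_index_enum => /(_ isT) /=; rewrite sqrf_eq0 => /eqP.
move: e2; rewrite -[RHS](mulr0 kappa) => /(mulfI (lt0r_neq0 k0)).
rewrite -mulrA -[RHS](mulr0 (u z `^ (a - 1))).
exact: (mulfI (lt0r_neq0 (powR_gt0 _ (u0 z)))).
Qed.

End Liouville.

(** * Bounded solutions in dimension three *)

Section DimensionThree.
Context {R : realType} {n : nat}.
Local Notation V := 'rV[R]_n.
Local Notation e i := (delta_mx 0 i : V).

(** [f(s) s^(- beta)] has derivative [- s^(- beta - 1) (beta f(s) - s f'(s)) <= 0]. *)
Lemma powR_ratio_nincr (f df : R -> R) (beta : R) :
  (forall s : R, 0 < s -> is_derive s 1 f (df s)) ->
  (forall s : R, 0 < s -> 0 <= beta * f s - s * df s) ->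
  forall s t : R, 0 < s -> s <= t -> f t * s `^ beta <= f s * t `^ beta.
Proof.
move=> fd fbeta s t s0 st; have t0 : 0 < t by exact: lt_le_trans st.
pose g (r : R) := f r * r `^ (- beta).
pose dg (r : R) := f r * (- beta * r `^ (- beta - 1)) + r `^ (- beta) * df r.
have gd (r : R) : 0 < r -> is_derive r 1 g (dg r) by move=> r0; exact: is_derive_fpowR.
have gts : g t <= g s.
  apply: (@ler0_derive1_nincr R g s t) => //.
  - move=> r; rewrite in_itv /= => /andP[sr _].
    by have [] := gd r (lt_trans s0 sr).
  - move=> r; rewrite in_itv /= => /andP[sr _].
    have r0 := lt_trans s0 sr.
    rewrite derive1E; have [_ ->] := gd r r0.
    rewrite /dg (powR_sub1 (- beta) r0).
    have -> : f r * (- beta * r `^ (- beta - 1)) + r `^ (- beta - 1) * r * df r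
      = - (r `^ (- beta - 1) * (beta * f r - r * df r)) by ring.
    by rewrite oppr_le0 mulr_ge0 ?powR_ge0 ?fbeta.
  - apply: derivable_within_continuous => r; rewrite in_itv /= => /andP[sr _].
    by have [] := gd r (lt_le_trans s0 sr).
have ps : 0 < s `^ beta by exact: powR_gt0.
have pt : 0 < t `^ beta by exact: powR_gt0.
move: gts; rewrite /g !powRN ler_pdivrMr// mulrAC ler_pdivlMr//.
Qed.

(** If [h x > 0], the first derivative increases along the line near [x]; but maximality makes it
    nonnegative somewhere to the left of [x] and nonpositive somewhere to the right. *)
Lemma second_derivative_le0 i (v w h : V -> R) (x : V) (d : R) :
  C1_along i v w -> C1_along i w h -> 0 < d ->
  (forall t, `|t| < d -> v (t *: e i + x) <= v x) -> h x <= 0.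
Proof.
move=> vw wh d0 vmax; rewrite leNgt; apply/negP => hx0.
have [_ ch _] := wh.
have : \forall t \near (0 : R), 0 < h (t *: e i + x).
  have ct : h (t *: e i + x) @[t --> (0 : R)] --> h (0 *: e i + x).
    apply: (@continuous_comp _ _ _ (fun t : R => t *: e i + x) h); last exact: ch.
    by apply: cvgD; [apply: cvgZr_tmp; exact: cvg_id|exact: cvg_cst].
  by apply: (cvgr_gt _ ct); rewrite scale0r add0r.
move=> /nbhs_ballP[d' /= d'0 hd'].
pose t := Num.min d d' / 2.
have dd : 0 < Num.min d d' by rewrite lt_min d0.
have t0 : 0 < t by rewrite divr_gt0.
have : t < Num.min d d' by rewrite ltr_pdivrMr// ltr_pMr// ltr1n.
rewrite lt_min => /andP[td td'].
have [a /andP[a0 at_] Ea] := mvt_along x vw t0.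
have [b /andP[b0 bt] Eb] := mvt_along (- t *: e i + x) vw t0.
have wa : w (a *: e i + x) <= 0.
  rewrite -(pmulr_lle0 _ t0) -Ea subr_le0; apply: vmax.
  by rewrite gtr0_norm.
have wb : 0 <= w (b *: e i + (- t *: e i + x)).
  rewrite -(pmulr_lge0 _ t0) -Eb addrA -scalerDl subrr scale0r add0r subr_ge0.
  by apply: vmax; rewrite normrN gtr0_norm.
have ab : 0 < a + (t - b) by lra.
have [c /andP[c0 cab] Ec] := mvt_along (b *: e i + (- t *: e i + x)) wh ab.
have hc : 0 < h (c *: e i + (b *: e i + (- t *: e i + x))).
  rewrite !addrA -!scalerDl; apply: hd'.
  by rewrite /ball /= sub0r normrN ltr_norml; apply/andP; split; lra.
have e1 : (a + (t - b)) *: e i + (b *: e i + (- t *: e i + x)) = a *: e i + x.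
  by rewrite !addrA -!scalerDl; congr (_ *: _ + _); ring.
have := mulr_gt0 hc ab; rewrite -Ec e1; lra.
Qed.

(** Suppose [f (u z) < 0]; then [f t <= f (u z)] for all [t >= u z]. Since [u <= M], the function
    [u - eps |x - z|^2] has an interior maximum [x1] over a large cube. There [u x1 >= u z], while
    the Laplacian of [u] is at most [2 n eps]. It also equals [- f (u x1) >= - f (u z) = 4 n eps], a
    contradiction. *)
Lemma bounded_source_ge0 (u : V -> R) (p : 'I_n -> V -> R) (H : 'I_n -> 'I_n -> V -> R)
    (f df : R -> R) (beta M : R) :
  (0 < n)%N ->
  (forall i, C1_along i u (p i)) -> (forall i j, C1_along j (p i) (H i j)) ->
  (forall x, 0 < u x) -> (forall x, u x <= M) ->
  (forall s : R, 0 < s -> is_derive s 1 f (df s)) ->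
  (forall x, \sum_i H i i x = - f (u x)) -> 0 <= beta ->
  (forall s : R, 0 < s -> 0 <= beta * f s - s * df s) ->
  forall x, 0 <= f (u x).
Proof.
move=> n0 up pH u0 uM fd lap b0 fbeta z; rewrite leNgt; apply/negP => fz.
have fle t : u z <= t -> f t <= f (u z).
  move=> zt; have := powR_ratio_nincr fd fbeta (u0 z) zt.
  have pz : 0 < u z `^ beta by exact: powR_gt0.
  have pt : u z `^ beta <= t `^ beta.
    by rewrite ge0_ler_powR ?nnegrE// ltW// (lt_le_trans _ zt).
  move=> h; rewrite -(ler_pM2r pz) (le_trans h)// ler_nM2l//.
have nn : 0 < n%:R :> R by rewrite ltr0n.
pose eps := - f (u z) / (4 * n%:R).
have e0 : 0 < eps by rewrite divr_gt0 ?oppr_gt0 ?mulr_gt0.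
have M0 : 0 < M by exact: lt_le_trans (u0 z) (uM z).
pose L := (Num.truncn (M / eps)).+1.
have LM : M < eps * L%:R.
  by rewrite mulrC -ltr_pdivrMr//; exact: truncnS_gt.
have L1 : 1 <= L%:R :> R by rewrite ler1n.
pose v x := u x + eps * sqcut z 1 x.
have i0 : 'I_n by exact: Ordinal n0.
have cu : continuous u by case: (up i0).
have cs : continuous (sqcut z 1) by case: (C1_along_sqcut z 1 i0).
have bz : box z L z by move=> k; rewrite subrr normr0.
have cv : continuous v.
  by move=> x; exact: (cvgD (cu x) (cvgM (cvg_cst eps) (cs x))).
have [x1 x1b x1m] : exists2 c, c \in box z L & forall t, t \in box z L -> v t <= v c.
  apply: EVT_max_rV; first by exists z.
    exact: compact_box.
  exact: continuous_subspaceT.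
rewrite inE in x1b.
have sz : sqcut z 1 z = 1.
  by rewrite /sqcut big1 ?mul0r ?subr0// => k _; rewrite subrr expr0n.
have vz : u z + eps <= v x1.
  by have := x1m z; rewrite inE => /(_ bz); rewrite /v sz mulr1.
have sq (j : 'I_n) : sqcut z 1 x1 <= 1 - (x1 0 j - z 0 j) ^+ 2.
  rewrite /sqcut expr1n divr1 lerD2l lerN2 (bigD1 j)//= lerDl.
  by apply: sumr_ge0 => k _; exact: sqr_ge0.
have inside j : `|x1 0 j - z 0 j| < L%:R.
  rewrite lt_neqAle x1b andbT; apply/eqP => xL.
  have := sq j; rewrite -[(_ - _) ^+ 2]real_normK ?num_real// xL => sq1.
  have := uM x1; have := u0 z; move: vz; rewrite /v => vz uz uM1.
  have : eps * sqcut z 1 x1 <= eps * (1 - L%:R ^+ 2) by rewrite ler_wpM2l// ltW.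
  have : eps * L%:R <= eps * L%:R ^+ 2.
    by rewrite ler_wpM2l ?(ltW e0)// expr2 ler_peMl// (le_trans ler01).
  lra.
have hess i : H i i x1 - 2 * eps <= 0.
  pose dd := L%:R - `|x1 0 i - z 0 i|.
  have dd0 : 0 < dd by rewrite subr_gt0.
  have c1 : C1_along i v (fun x => p i x + eps * dcut z 1 i x).
    exact: (C1_alongD (up i) (C1_alongZ eps (C1_along_sqcut z 1 i))).
  have c2 : C1_along i (fun x => p i x + eps * dcut z 1 i x) (fun x => H i i x - 2 * eps).
    have hd : C1_along i (dcut z 1 i) (fun=> -2).
      have hh := C1_alongZ (-2) (C1_alongD (C1_along_coord i i) (C1_along_cst i (- z 0 i))).
      apply: (C1_along_eq hh) => x; first by rewrite /dcut expr1n divr1 mulNr.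
      by rewrite eqxx addr0 mulr1.
    apply: (C1_along_eq (C1_alongD (pH i i) (C1_alongZ eps hd))) => // x.
    by rewrite mulrN mulrC.
  apply: (second_derivative_le0 c1 c2 dd0) => t td; apply: x1m; rewrite inE => j.
  rewrite !mxE eqxx /=; have [->|_] := eqVneq j i; last first.
    by rewrite mulr0 add0r ltW.
  rewrite mulr1 -addrA (le_trans (ler_normD _ _))// -lerBrDr ltW//.
have : \sum_i H i i x1 <= n%:R * (2 * eps).
  have -> : n%:R * (2 * eps) = \sum_(i < n) (2 * eps).
    by rewrite sumr_const card_ord mulr_natl.
  by apply: ler_sum => i _; rewrite -subr_le0.
rewrite lap; have ux1 : u z <= u x1.
  have : sqcut z 1 x1 <= 1.
    rewrite /sqcut lerBlDr lerDl divr_ge0 ?exprn_ge0//.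
    by apply: sumr_ge0 => i _; exact: sqr_ge0.
  move=> s1; have : eps * sqcut z 1 x1 <= eps by rewrite ler_piMr// ltW.
  by move: vz; rewrite /v; lra.
have := fle _ ux1.
have -> : n%:R * (2 * eps) = - f (u z) / 2 by rewrite /eps; field; rewrite gt_eqF.
lra.
Qed.

Lemma grad_eq0_const (u : V -> R) :
  (forall i, C1_along i u (fun=> 0)) -> forall x, u x = u 0.
Proof.
move=> h.
have step i t x : u (t *: e i + x) = u x.
  have pos s y : 0 < s -> u (s *: e i + y) = u y.
    move=> s0; have [r _] := mvt_along y (h i) s0.
    by rewrite mul0r => /eqP; rewrite subr_eq0 => /eqP.
  have [t0|t0|->] := ltgtP t 0; last by rewrite scale0r add0r.
    have := pos (- t) (t *: e i + x); rewrite oppr_gt0 => /(_ t0).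
    by rewrite addrA -scalerDl addNr scale0r add0r.
  exact: pos.
move=> x; rewrite [x]row_sum_delta.
elim: (index_enum _) => [|k s ih]; first by rewrite big_nil.
by rewrite big_cons step.
Qed.

End DimensionThree.

(** * Positive harmonic functions and bounded solutions for n = 3 *)

Section BoundedSolutions.
Context {R : realType} {n : nat}.
Hypothesis n3 : n = 3%N.
Local Notation V := 'rV[R]_n.
Local Notation e i := (delta_mx 0 i : V).

Lemma grad2_eq0 (p : 'I_n -> V -> R) x : grad2 p x = 0 -> forall i, p i x = 0.
Proof.
move=> /eqP; rewrite psumr_eq0 => [/allP h i|i _]; last exact: sqr_ge0.
by have := h i; rewrite mem_index_enum => /(_ isT) /=; rewrite sqrf_eq0 => /eqP.
Qed.

(* [u] and [u + 1] are both positive and harmonic, so the tensor [tracefree]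
   vanishes for both, which forces [Du (x) Du] to be a multiple of the identity. *)
Lemma positive_harmonic_grad_eq0 (u : V -> R) (p : 'I_n -> V -> R)
    (H : 'I_n -> 'I_n -> V -> R) :
  (forall i, C1_along i u (p i)) -> (forall i j, C1_along j (p i) (H i j)) ->
  (forall x, 0 < u x) -> (forall x, \sum_i H i i x = 0) -> forall i x, p i x = 0.
Proof.
move=> up pH u0 lap i x.
have beta5 : 2 < (n%:R + 2) / (n%:R - 2) :> R.
  by rewrite n3 ltr_pdivlMr; lra.
have z0 (v : V -> R) : (forall y, 0 < v y) -> (forall i, C1_along i v (p i)) ->
    forall i j, tracefree v p H (fun=> 0) i j x = 0.
  move=> v0 vp.
  have [] // := @tracefree_eq0 R n v p H (fun=> 0) (fun=> 0) 2 n3 vp pH v0 _ _ _ beta5 _ _ x.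
  - by move=> s _; exact: cst_continuous.
  - by move=> y; rewrite lap oppr0.
  - by move=> s _; rewrite !mulr0 subr0.
have up1 k : C1_along k (fun y => u y + 1) (p k).
  by apply: (C1_along_eq (C1_alongD (up k) (C1_along_cst k 1))) => // y; rewrite addr0.
have u1 y : 0 < u y + 1 by rewrite addr_gt0.
have n0 : n%:R != 0 :> R by rewrite n3.
have n2 : n%:R - 2 != 0 :> R by rewrite n3; apply/eqP; lra.
have T0 k l : p k x * p l x = grad2 p x / n%:R * (k == l)%:R.
  have := z0 u u0 up k l; have := z0 _ u1 up1 k l.
  rewrite /tracefree; set d := (_ == _)%:R.
  have a1 : u x != 0 by rewrite gt_eqF.
  have a2 : u x + 1 != 0 by rewrite gt_eqF.
  move: (p k x * p l x) (H k l x) (grad2 p x) (u x) a1 a2 d => t h P ux a1 a2 d h1 h2.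
  apply/eqP; rewrite -subr_eq0; apply/eqP.
  have : (- n%:R / (n%:R - 2)) * (ux^-1 - (ux + 1)^-1) * (t - P / n%:R * d) = 0.
    have h3 := congr2 (fun a b : R => a - b) h2 h1.
    rewrite subrr in h3; rewrite -h3; field.
    by rewrite a1 a2 n0 n2.
  move=> /eqP; rewrite !mulf_eq0 oppr_eq0 invr_eq0 (negPf n0) (negPf n2) /=.
  have -> : ux^-1 - (ux + 1)^-1 = (ux * (ux + 1))^-1 by field; rewrite a1 a2.
  by rewrite invr_eq0 mulf_eq0 (negPf a1) (negPf a2) => /eqP.
(* For [j != i] the product [p i * p j] is 0 and the two squares agree, so both components
   vanish. *)
have [j ji] : exists j, j != i.
  case: (eqVneq i (cast_ord (esym n3) ord0)) => [->|ni].
    by exists (cast_ord (esym n3) ord_max).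
  by exists (cast_ord (esym n3) ord0); rewrite eq_sym.
have := T0 i j; rewrite eq_sym (negPf ji) mulr0 => pij.
have := T0 i i; have := T0 j j; rewrite !eqxx !mulr1 => <- pp.
move: pij => /eqP; rewrite mulf_eq0 => /orP[/eqP //|/eqP pj].
by move: pp => /eqP; rewrite pj mul0r mulf_eq0 orbb => /eqP.
Qed.

Lemma bounded_solution_const (u : V -> R) (f : R -> R) (beta : R) :
  (forall s : R, 0 < s -> derivable f s 1) ->
  (forall s : R, 0 < s -> {for s, continuous (derive1 f)}) ->
  0 <= beta -> beta < (n%:R + 2) / (n%:R - 2) ->
  (forall s : R, 0 < s -> 0 <= beta * f s - s * derive1 f s) ->
  positive_solution f u -> bounded_fun u -> exists c : R, u = cst c.
Proof.
move=> fd fc b0 bn fb [[uC2 ueq] u0] ub.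
pose p i := partial i u; pose H i j := partial j (p i).
have up i : C1_along i u (p i) by exact: C2_grad.
have pH i j : C1_along j (p i) (H i j) by exact: C2_hess.
have fd' (s : R) : 0 < s -> is_derive s 1 f (derive1 f s).
  by move=> s0; rewrite derive1E; apply/derivableP; exact: fd.
have lap x : \sum_i H i i x = - f (u x).
  by apply/eqP; rewrite -addr_eq0; apply/eqP; exact: ueq.
have [M uM] : exists M, forall x, u x <= M.
  have [M [_ hM]] := ub; exists (`|M| + 1) => x.
  apply: (le_trans (ler_norm _)); apply: (hM (`|M| + 1)) => //.
  by rewrite (le_lt_trans (ler_norm _))// ltrDl.
have n0 : (0 < n)%N by rewrite n3.
have fu0 := bounded_source_ge0 n0 up pH u0 uM fd' lap b0 fb.
have key := tracefree_eq0 n3 up pH u0 fd' fc lap bn fb fu0.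
have i0 : 'I_n := Ordinal n0.
have cfu : continuous (fun x => f (u x)).
  by case: (C1_along_weight up u0 fd' fc i0).
(* If [f (u z) > 0], then [f(u) > 0] near [z], so the gradient vanishes near [z], hence the
   Laplacian vanishes at [z], and the equation gives [f (u z) = 0]. *)
have fu z : f (u z) = 0.
  apply/eqP; rewrite eq_le fu0 andbT leNgt; apply/negP => fz.
  have near_pos : \forall x \near z, 0 < f (u x) by exact: (cvgr_gt _ (cfu z)).
  have Hz i : H i i z = 0.
    have pz : \forall x \near z, 0 = p i x.
      apply: filterS near_pos => x fx; have [_ /eqP] := key x.
      by rewrite mulf_eq0 gt_eqF//= => /eqP /grad2_eq0 ->.
    have := near_eq_is_derive pz (is_derive_cst (0 : R) z (e i)).
    by have [_ _ /(_ z) [_ <-]] := pH i i; case=> _ <-.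
  by have := lap z; rewrite big1// => /eqP; rewrite eq_sym oppr_eq0 gt_eqF.
have p0 : forall i x, p i x = 0.
  by apply: (positive_harmonic_grad_eq0 up pH u0) => x; rewrite lap fu oppr0.
exists (u 0); apply/funext => x; apply: grad_eq0_const => i.
by apply: (C1_along_eq (up i)) => // y; exact: p0.
Qed.

End BoundedSolutions.

(** * Solutions in dimension at least four *)

Section Exponents.
Context {R : realType}.

(** Young's inequality by cases on the size of [s^d (rho l)^4]. If it is large, [F >= c s^q] makes
    the source term dominate. Otherwise [s^d] is at most a multiple of [(rho l)^-4]; raising to the
    power [th = g / d] gives the decay in [l], and [k >= 4 th] compensates the negative power of
    [rho]. *)
Lemma absorb_low_power (a t q c eps : R) (k : nat) :
  0 < eps -> 0 < c -> 0 < 2 * q - 2 - t -> 0 < a + 2 + t ->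
  4 * ((a + 2 + t) / (2 * q - 2 - t)) <= k%:R ->
  exists2 C : R, 0 <= C & forall l rho s F : R,
    1 <= l -> 0 <= rho -> rho <= 1 -> 0 < s -> c * s `^ q <= F ->
    l ^- 4 * (rho ^+ k * s `^ (a + 2 + t)) <=
    eps * (rho ^+ (k + 4) * s `^ a * F ^+ 2)
    + C * l `^ (- (4 + 4 * ((a + 2 + t) / (2 * q - 2 - t)))).
Proof.
set d := 2 * q - 2 - t; set g := a + 2 + t; set th := g / d.
move=> e0 c0 d0 g0 thk.
have th0 : 0 < th by rewrite divr_gt0.
pose M := (eps * c ^+ 2)^-1.
have ec0 : 0 < eps * c ^+ 2 by rewrite mulr_gt0 ?exprn_gt0.
exists (M `^ th); first exact: powR_ge0.
move=> l rho s F l1 r0 r1 s0 sF.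
have l0 : 0 < l by exact: lt_le_trans ltr01 l1.
have rk0 : 0 <= rho ^+ k by exact: exprn_ge0.
have sa0 : 0 <= s `^ a by exact: powR_ge0.
have sg0 : 0 <= s `^ g by exact: powR_ge0.
have sd0 : 0 <= s `^ d by exact: powR_ge0.
have snz p1 p2 : s `^ (p1 + p2) = s `^ p1 * s `^ p2.
  by rewrite powRD// (gt_eqF s0) implybT.
have l40 : 0 < l ^+ 4 by exact: exprn_gt0.
pose A := s `^ d * (rho ^+ 4 * l ^+ 4).
have [MA|AM] := leP M A.
  rewrite ler_wpDr ?mulr_ge0 ?powR_ge0//.
  have h1 : 1 <= eps * c ^+ 2 * A by rewrite mulrC -ler_pdivrMr// div1r.
  have h2 : (c * s `^ q) ^+ 2 <= F ^+ 2.
    by rewrite lerXn2r ?nnegrE ?mulr_ge0 ?powR_ge0 ?(ltW c0)// (le_trans _ sF)// mulr_ge0 ?powR_ge0 ?(ltW c0).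
  have E : s `^ d * s `^ g = s `^ a * (s `^ q) ^+ 2.
    by rewrite expr2 -!snz; congr (_ `^ _); rewrite /d /g; ring.
  have l4 : 0 <= l ^- 4 by rewrite invr_ge0 ltW.
  apply: (@le_trans _ _ (l ^- 4 * (rho ^+ k * s `^ g) * (eps * c ^+ 2 * A))).
    by rewrite ler_peMr// !mulr_ge0.
  have -> : l ^- 4 * (rho ^+ k * s `^ g) * (eps * c ^+ 2 * A) =
    eps * (rho ^+ k * rho ^+ 4 * c ^+ 2) * (s `^ d * s `^ g).
    by rewrite /A; field; rewrite gt_eqF.
  rewrite E -exprD.
  have -> : eps * (rho ^+ (k + 4) * c ^+ 2) * (s `^ a * (s `^ q) ^+ 2) =
    eps * (rho ^+ (k + 4) * s `^ a * (c * s `^ q) ^+ 2) by ring.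
  by apply: ler_wpM2l; [exact: ltW|apply: ler_wpM2l => //; rewrite mulr_ge0// exprn_ge0].
apply: ler_wpDl.
  apply: mulr_ge0; first exact: ltW.
  by apply: mulr_ge0; [rewrite mulr_ge0 ?exprn_ge0|exact: sqr_ge0].
have h1 : s `^ g * ((rho ^+ 4) `^ th * (l ^+ 4) `^ th) <= M `^ th.
  have -> : s `^ g = (s `^ d) `^ th by rewrite -powRrM /th mulrCA divff ?mulr1 ?gt_eqF.
  rewrite -!powRM ?exprn_ge0 ?mulr_ge0 ?exprn_ge0 ?(ltW l0)//.
  by rewrite ge0_ler_powR ?nnegrE ?(ltW th0) ?(ltW AM) ?mulr_ge0 ?exprn_ge0 ?(ltW l0) ?invr_ge0 ?(ltW ec0).
have h2 : rho ^+ k <= (rho ^+ 4) `^ th.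
  have [->|rn0] := eqVneq rho 0.
    have k0 : (0 < k)%N by rewrite -(ltr_nat R) (lt_le_trans _ thk)// mulr_gt0.
    by rewrite expr0n gtn_eqF//= powR_ge0.
  rewrite -powR_mulrn// -[rho ^+ 4]powR_mulrn// -powRrM.
  by rewrite ger_powR// lt_neqAle eq_sym rn0 r0.
have h3 : (l ^+ 4) `^ th = l `^ (4 * th).
  by rewrite -powR_mulrn ?(ltW l0)// -powRrM.
have -> : l `^ (- (4 + 4 * th)) = l ^- 4 * (l `^ (4 * th))^-1.
  rewrite powRN powRD; last by rewrite (gt_eqF l0) implybT.
  by rewrite (powR_mulrn 4 (ltW l0)) invfM.
rewrite [leRHS]mulrCA ler_wpM2l ?invr_ge0 ?(ltW l40)//.
rewrite ler_pdivlMr ?powR_gt0// -h3.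
apply: (le_trans _ h1); rewrite [rho ^+ k * _]mulrC -mulrA ler_wpM2l//.
by rewrite ler_wpM2r ?powR_ge0.
Qed.

(** The decay rate decreases in [q] and equals [n + 1] at [t = 0] and the critical [q], so it still
    exceeds [n] after a small shift. The range of [t] is [2 delta] because completing the square
    doubles a shift. *)
Lemma exponent_gap (n : nat) (alpha beta : R) : (4 <= n)%N ->
  1 < alpha -> alpha <= beta -> beta < (n%:R + 2) / (n%:R - 2) ->
  let a : R := - 2 / (n%:R - 2) in
  exists delta sigma k, [/\ 0 < delta, n%:R < sigma,
    a + 1 + delta != 0, a + 1 - delta != 0 &
    forall t q, `|t| <= 2 * delta -> alpha <= q <= beta ->
    [/\ 0 < 2 * q - 2 - t, 0 < a + 2 + t,
      sigma <= 4 + 4 * ((a + 2 + t) / (2 * q - 2 - t)) &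
      4 * ((a + 2 + t) / (2 * q - 2 - t)) <= (k : nat)%:R]].
Proof.
move=> n4 al1 ab bn a.
have nn4 : 4 <= n%:R :> R by rewrite ler_nat.
(* The bound [n^-2] keeps the rate above [n] and [a + 1 - delta] away from 0; the bound
   [(alpha - 1) / 2] keeps [2 q - 2 - t] positive. *)
pose delta := Num.min (n%:R ^- 2) ((alpha - 1) / 2).
have nd0 : 0 < n%:R ^- 2 :> R by rewrite invr_gt0 exprn_gt0// (lt_le_trans _ nn4).
have d0 : 0 < delta by rewrite lt_min nd0 divr_gt0// subr_gt0.
have d1 : delta * n%:R ^+ 2 <= 1.
  rewrite -ler_pdivlMr ?div1r ?ge_min ?lexx// exprn_gt0// (lt_le_trans _ nn4)//.
have d2 : 2 * delta <= alpha - 1.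
  by rewrite mulrC -ler_pdivlMr// ge_min lexx orbT.
have aE : a * (n%:R - 2) = -2 by rewrite /a divfK// subr_eq0 gt_eqF// (lt_le_trans _ nn4)// ltr_nat.
have bE : beta * (n%:R - 2) < n%:R + 2 by rewrite -ltr_pdivlMr// subr_gt0 (lt_le_trans _ nn4)// ltr_nat.
have d16 : delta <= 16^-1.
  have : delta * 16 <= delta * n%:R ^+ 2 by apply: ler_wpM2l; [exact: ltW|nra].
  lra.
have n20 : 0 < n%:R - 2 :> R by lra.
have a1 : -1 <= a by rewrite -(ler_pM2r n20) aE; lra.
pose sigma := 4 + 4 * ((a + 2 - 2 * delta) / (2 * beta - 2 + 2 * delta)).
pose K := 4 * ((a + 2 + 2 * delta) / (2 * alpha - 2 - 2 * delta)).
have den0 : 0 < 2 * alpha - 2 - 2 * delta by lra.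
have den1 : 0 < 2 * beta - 2 + 2 * delta by lra.
exists delta, sigma, (Num.truncn K).+1; split => //.
- rewrite /sigma -ltrBlDl mulrA ltr_pdivlMr//.
  have h1 : (n%:R - 4) * (beta * (n%:R - 2)) <= (n%:R - 4) * (n%:R + 2).
    by rewrite ler_wpM2l ?subr_ge0// ltW.
  rewrite -(ltr_pM2r n20).
  have h3 : delta * n%:R * (n%:R - 2) <= 1.
    have : 0 <= delta * n%:R by rewrite mulr_ge0// ltW.
    by move: d1; rewrite expr2; lra.
  move: h1 h3 aE; move: (n%:R) => N h1 h3 aE; lra.
- by rewrite gt_eqF//; lra.
- move: n4; rewrite leq_eqVlt => /predU1P[n4|n5].
    by have a1' : a = -1 by [rewrite /a -n4; field]; rewrite a1'; apply/eqP; lra.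
  have nn5 : 5 <= n%:R :> R by rewrite ler_nat.
  have : 3^-1 <= a + 1 by rewrite -(ler_pM2r n20) mulrDl aE; lra.
  by move=> h; rewrite gt_eqF//; lra.
move=> t q; rewrite ler_norml => /andP[t1 t2] /andP[q1 q2].
have p1 : 0 < 2 * q - 2 - t by lra.
have p2 : 0 < a + 2 + t by lra.
split => //.
  rewrite /sigma lerD2l ler_pM2l// ler_pM//; try lra.
    by rewrite invr_ge0 ltW.
  by rewrite lef_pV2 ?posrE//; lra.
apply: (@le_trans _ _ K); last exact/ltW/truncnS_gt.
rewrite /K ler_pM2l// ler_pM//; try lra.
  by rewrite invr_ge0 ltW.
by rewrite lef_pV2 ?posrE//; lra.
Qed.

End Exponents.

(** * Absorption into the source energy for n >= 4 *)

Section Unbounded.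
Context {R : realType} {n : nat}.
Local Notation V := 'rV[R]_n.
Variables (u : V -> R) (p : 'I_n -> V -> R) (H : 'I_n -> 'I_n -> V -> R).
Variables (f df : R -> R) (alpha beta c : R) (z : V).
Hypothesis n_ge4 : (4 <= n)%N.
Hypothesis u_grad : forall i, C1_along i u (p i).
Hypothesis u_hess : forall i j, C1_along j (p i) (H i j).
Hypothesis u_gt0 : forall x, 0 < u x.
Hypothesis f_deriv : forall s : R, 0 < s -> is_derive s 1 f (df s).
Hypothesis df_cont : forall s : R, 0 < s -> {for s, continuous df}.
Hypothesis u_eq : forall x, \sum_i H i i x = - f (u x).
Hypothesis f_beta : forall s : R, 0 < s -> 0 <= beta * f s - s * df s.
Hypothesis beta_gt1 : 1 < beta.
Hypothesis beta_subcritical : beta < (n%:R + 2) / (n%:R - 2).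
Hypothesis c_gt0 : 0 < c.
Hypothesis f_ge : forall s : R, 0 < s -> c * s `^ alpha <= f s \/ c * s `^ beta <= f s.
Hypothesis alpha_le_beta : alpha <= beta.

Local Notation a := (- 2 / (n%:R - 2) : R).
Local Notation P := (grad2 p).

Variables (delta sigma : R) (k : nat).
Hypothesis delta_gt0 : 0 < delta.
Hypothesis sigma_gt_n : n%:R < sigma.
Hypothesis aDdelta : a + 1 + delta != 0.
Hypothesis aBdelta : a + 1 - delta != 0.
Hypothesis gap : forall t q : R, `|t| <= 2 * delta -> alpha <= q <= beta ->
    [/\ 0 < 2 * q - 2 - t, 0 < a + 2 + t,
      sigma <= 4 + 4 * ((a + 2 + t) / (2 * q - 2 - t)) &
      4 * ((a + 2 + t) / (2 * q - 2 - t)) <= k%:R].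

Lemma source_gt0 s : 0 < s -> 0 < f s.
Proof.
by move=> s0; case: (f_ge s0) => /(lt_le_trans _); apply; rewrite mulr_gt0 ?powR_gt0.
Qed.

(** Two successive losses of two cutoff powers lead from [k + 5] to [k + 1], the power in
    [dominated_power]. *)
Definition source_energy L x : R :=
  cutoff z L x ^+ k.+4.+1 * u x `^ a * f (u x) ^+ 2.

Lemma source_energy_ge0 L x : 0 <= source_energy L x.
Proof.
apply: mulr_ge0; last exact: sqr_ge0.
by rewrite mulr_ge0 ?powR_ge0// exprn_ge0// cutoff_ge0.
Qed.

(* [Y] is absorbed, up to a divergence and a term that decays faster than the
   volume [L ^ n], by an arbitrarily small multiple of [source_energy]. *)
Definition dominated (Y : nat -> V -> R) : Prop :=
  forall eps : R, 0 < eps -> exists2 C : R, 0 <= C &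
    forall L, (0 < L)%N -> exists2 D, null z L D &
      forall x, Y L x <= D x + eps * source_energy L x + C * L%:R `^ (- sigma).

Lemma dominated_le (Y Y' : nat -> V -> R) : dominated Y' ->
  (forall L, (0 < L)%N -> exists2 D, null z L D & forall x, Y L x <= D x + Y' L x) ->
  dominated Y.
Proof.
move=> h hY eps e0; have [C C0 hC] := h eps e0; exists C => // L L0.
have [D nD hD] := hC L L0; have [D' nD' hD'] := hY L L0.
exists (fun x => D' x + D x); first exact: nullD.
by move=> x; rewrite (le_trans (hD' x))// -!addrA lerD2l addrA.
Qed.

Lemma dominatedD (Y Y' : nat -> V -> R) : dominated Y -> dominated Y' ->
  dominated (fun L x => Y L x + Y' L x).
Proof.
move=> h h' eps e0; have e2 : 0 < eps / 2 by rewrite divr_gt0.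
have [C C0 hC] := h _ e2; have [C' C'0 hC'] := h' _ e2.
exists (C + C'); first by rewrite addr_ge0.
move=> L L0; have [D nD hD] := hC L L0; have [D' nD' hD'] := hC' L L0.
exists (fun x => D x + D' x); first exact: nullD.
move=> x; apply: (le_trans (lerD (hD x) (hD' x))); lra.
Qed.

Lemma dominatedZ (b : R) (Y : nat -> V -> R) : 0 <= b -> dominated Y ->
  dominated (fun L x => b * Y L x).
Proof.
move=> b0 h eps e0; have b1 : 0 < 1 + b by lra.
have e2 : 0 < eps / (1 + b) by rewrite divr_gt0.
have [C C0 hC] := h _ e2; exists (b * C); first by rewrite mulr_ge0.
move=> L L0; have [D nD hD] := hC L L0.
exists (fun x => b * D x); first exact: nullZ.
move=> x; apply: (le_trans (ler_wpM2l b0 (hD x))).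
have E0 := source_energy_ge0 L x.
have : b * (eps / (1 + b) * source_energy L x) <= eps * source_energy L x.
  rewrite mulrA ler_wpM2r// mulrCA ler_piMr ?(ltW e0)//.
  by rewrite ler_pdivrMr// mul1r; lra.
rewrite !mulrDr mulrA; lra.
Qed.

Let cut0 L x m : 0 <= cutoff z L x ^+ m.
Proof. by rewrite exprn_ge0// cutoff_ge0. Qed.

Lemma dominated_power t : `|t| <= 2 * delta ->
  dominated (fun L x => L%:R ^- 4 * (cutoff z L x ^+ k.+1 * u x `^ (a + 2 + t))).
Proof.
move=> td eps e0.
have h q : alpha <= q <= beta -> exists2 C : R, 0 <= C & forall L x, (0 < L)%N ->
    c * u x `^ q <= f (u x) ->
    L%:R ^- 4 * (cutoff z L x ^+ k.+1 * u x `^ (a + 2 + t)) <=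
    eps * source_energy L x + C * L%:R `^ (- sigma).
  move=> qab; have [g1 g2 g3 g4] := gap td qab.
  have g5 : 4 * ((a + 2 + t) / (2 * q - 2 - t)) <= k.+1%:R.
    by rewrite (le_trans g4)// ler_nat.
  have [C C0 hC] := absorb_low_power e0 c_gt0 g1 g2 g5.
  exists C => // L x L0 cu.
  have L1 : 1 <= L%:R :> R by rewrite ler1n.
  have := hC _ _ _ _ L1 (cutoff_ge0 z L x) (cutoff_le1 z L x) (u_gt0 x) cu.
  rewrite addn4 => hh; apply: (le_trans hh); rewrite lerD2l ler_wpM2l//.
  by apply: ler_powR => //; rewrite lerN2.
have [C1 C10 h1] := h alpha ltac:(by rewrite lexx).
have [C2 C20 h2] := h beta ltac:(by rewrite lexx andbT).
exists (C1 + C2); first by rewrite addr_ge0.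
move=> L L0; exists (fun=> 0); first exact: null_cst0.
move=> x; rewrite add0r mulrDl.
have l1 : 0 <= C1 * L%:R `^ (- sigma) by rewrite mulr_ge0 ?powR_ge0.
have l2 : 0 <= C2 * L%:R `^ (- sigma) by rewrite mulr_ge0 ?powR_ge0.
by case: (f_ge (u_gt0 x)) => [/(h1 L x L0)|/(h2 L x L0)] hh; apply: (le_trans hh); lra.
Qed.

(** Completing a square splits the product into the source energy and the pure power term with shift
    [2 t], which is why the bound is imposed on [2 * t]. *)
Lemma dominated_source t : `|2 * t| <= 2 * delta ->
  dominated (fun L x => L%:R ^- 2 *
    (cutoff z L x ^+ k.+3 * u x `^ (a + 1 + t) * f (u x))).
Proof.
move=> td eps e0; pose eta := eps / 2.
have eta0 : 0 < eta by rewrite divr_gt0.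
have e4 : 0 <= (4 * eta)^-1 by rewrite invr_ge0 mulr_ge0// ltW.
have [C C0 hC] := dominatedZ e4 (dominated_power td) eta0.
exists C => // L L0; have [D nD hD] := hC L L0; exists D => // x.
have := hD x; set Y := _ * _ => hY.
suff h : L%:R ^- 2 * (cutoff z L x ^+ k.+3 * u x `^ (a + 1 + t) * f (u x)) <=
    eta * source_energy L x + Y.
  by apply: (le_trans h); rewrite /eta in hY *; lra.
rewrite /Y /source_energy.
have l0 : L%:R != 0 :> R by rewrite pnatr_eq0 -lt0n.
have pD b b' : u x `^ (b + b') = u x `^ b * u x `^ b'.
  by rewrite powRD// (gt_eqF (u_gt0 x)) implybT.
have -> : u x `^ (a + 1 + t) = u x `^ a * u x `^ (1 + t) by rewrite -pD addrA.
have -> : u x `^ (a + 2 + 2 * t) = u x `^ a * u x `^ (1 + t) ^+ 2.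
  by rewrite expr2 -!pD; congr (_ `^ _); ring.
have ua : 0 <= u x `^ a by exact: powR_ge0.
have rk := cut0 L x k.+1.
have E5 : cutoff z L x ^+ k.+4.+1 = cutoff z L x ^+ k.+1 * cutoff z L x ^+ 4.
  by rewrite -exprD addn4.
have E3 : cutoff z L x ^+ k.+3 = cutoff z L x ^+ k.+1 * cutoff z L x ^+ 2.
  by rewrite -exprD addn2.
rewrite E5 E3; move: (cutoff z L x ^+ k.+1) rk => rk rk0.
move: (cutoff z L x) (u x `^ a) ua => r w w0.
move: (u x `^ (1 + t)) (f (u x)) (L%:R) l0 => v fx l l0.
rewrite -subr_ge0.
have -> : eta * (rk * r ^+ 4 * w * fx ^+ 2) + (4 * eta)^-1 * (l ^- 4 * (rk * (w * v ^+ 2)))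
   - l ^- 2 * (rk * r ^+ 2 * (w * v) * fx) =
   rk * w / eta * (eta * r ^+ 2 * fx - l ^- 2 * v / 2) ^+ 2.
  by field; rewrite l0 gt_eqF.
by apply: mulr_ge0; [rewrite !mulr_ge0// invr_ge0 ltW|exact: sqr_ge0].
Qed.

Lemma dominated_grad t : `|t| <= delta -> a + 1 + t != 0 ->
  dominated (fun L x => L%:R ^- 2 * (cutoff z L x ^+ k.+3 * u x `^ (a + t) * P x)).
Proof.
move=> td e0.
have t1 : `|t| <= 2 * delta by rewrite (le_trans td)// ler_peMl ?ler1n// ltW.
have t2 : `|2 * t| <= 2 * delta by rewrite normrM ger0_norm// ler_pM2l.
set e := a + 1 + t in e0.
have b1 : 0 <= 4 * k.+3%:R ^+ 2 / e ^+ 2 :> R.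
  by rewrite divr_ge0 ?sqr_ge0// mulr_ge0// exprn_ge0.
have b2 : 0 <= 2 / `|e| by rewrite divr_ge0.
apply: (dominated_le (dominatedD (dominatedZ b1 (dominated_power t1))
   (dominatedZ b2 (dominated_source t2)))) => L L0.
have [D nD hD] := gradient_estimate z u_grad u_hess u_gt0 u_eq L0 k e0.
exists (fun x => L%:R ^- 2 * D x); first exact: nullZ.
move=> x; have := hD x.
have -> : e - 1 = a + t by rewrite /e; ring.
have -> : e + 1 = a + 2 + t by rewrite /e; ring.
have l0 : 0 < L%:R :> R by rewrite ltr0n.
have l2 : 0 <= L%:R ^- 2 :> R by rewrite invr_ge0 exprn_ge0// ltW.
move=> /(ler_wpM2l l2) h; apply: (le_trans h).
rewrite 2!mulrDr -addrA lerD2l; apply: lerD.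
  rewrite le_eqVlt; apply/orP; left; apply/eqP; field.
  by rewrite e0 gt_eqF.
rewrite mulrCA; apply: ler_wpM2r.
  by rewrite mulr_ge0// mulr_ge0 ?(ltW (source_gt0 _))// mulr_ge0 ?powR_ge0.
by rewrite ler_wpM2l// (le_trans (ler_norm _))// normfV.
Qed.

(** [dominated_grad] at shift 0 would require [a + 1 != 0], which fails for n = 4. Instead
    [u^a <= u^(a + delta) + u^(a - delta)], according to whether [u >= 1] or not. *)
Lemma dominated_energy :
  dominated (fun L x => L%:R ^- 2 * (cutoff z L x ^+ k.+3 * u x `^ a * P x)).
Proof.
have h1 : `|delta| <= delta by rewrite gtr0_norm.
have h2 : `|- delta| <= delta by rewrite normrN gtr0_norm.
apply: (dominated_le (dominatedD (dominated_grad h1 aDdelta) (dominated_grad h2 aBdelta))).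
move=> L L0; exists (fun=> 0); first exact: null_cst0.
move=> x; rewrite add0r -mulrDr ler_wpM2l ?invr_ge0 ?exprn_ge0//.
have P0 : 0 <= P x by apply: sumr_ge0 => i _; exact: sqr_ge0.
rewrite -mulrDl ler_wpM2r// -mulrDr ler_wpM2l//.
have [u1|u1] := leP 1 (u x).
  by rewrite ler_wpDr ?powR_ge0// ler_powR// lerDl ltW.
by rewrite ler_wpDl ?powR_ge0// ger_powR ?u_gt0 ?(ltW u1)// gerDl oppr_le0 ltW.
Qed.

(** The gradient term with [f(u)] in [source_estimate] is replaced, at the price
    [2 (beta + a) / kappa], using [tracefree_estimate]; [a >= -1] makes this factor nonnegative.
    Only the energy with [L^-2] remains, so the source energy is dominated by a small multiple of
    itself. *)
Lemma dominated_source_energy : dominated source_energy.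
Proof.
have n_ge3 : (2 < n)%N by exact: leq_trans n_ge4.
have nn4 : 4 <= n%:R :> R by rewrite ler_nat.
pose kappa : R := (1 - n%:R^-1) * ((n%:R + 2) / (n%:R - 2) - beta).
have k0 : 0 < kappa.
  rewrite mulr_gt0 ?subr_gt0// invf_lt1 ?ltr1n ?ltr0n; by case: n n_ge3 => [|[|]].
have a1 : -1 <= a.
  have n20 : 0 < n%:R - 2 :> R by lra.
  rewrite -(ler_pM2r n20) divfK; last by rewrite gt_eqF.
  by move: nn4; move: (n%:R) => N nn4; lra.
have ba : 0 <= beta + a.
  by apply: (@le_trans _ _ (beta - 1)); [rewrite subr_ge0 ltW|rewrite lerD2l].
pose m : R := k.+4.+1%:R.
pose b := 4 * m ^+ 2 + 2 * (beta + a) / kappa * (2 * m ^+ 2).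
have m0 : 0 <= m ^+ 2 by exact: sqr_ge0.
have bk : 0 <= 2 * (beta + a) / kappa by apply: divr_ge0; [exact: mulr_ge0|exact: ltW].
have b0 : 0 <= b.
  by apply: addr_ge0; [exact: mulr_ge0|apply: mulr_ge0 => //; exact: mulr_ge0].
apply: (dominated_le (dominatedZ b0 dominated_energy)) => L L0.
have [D nD hD] := source_estimate z u_grad u_hess u_gt0 f_deriv df_cont u_eq L0 f_beta a k.+2.
have [D' nD' hD'] := tracefree_estimate z u_grad u_hess u_gt0 f_deriv df_cont u_eq L0 n_ge3 f_beta k.+2.
exists (fun x => D x + 2 * (beta + a) / kappa * D' x).
  by apply: nullD => //; exact: nullZ.
move=> x; have := hD x; have := hD' x; rewrite -/kappa -/m /source_energy.
have EE0 : 0 <= 2^-1 * (cutoff z L x ^+ k.+4.+1 * u x `^ a *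
     \sum_i \sum_j tracefree u p H f i j x ^+ 2).
  apply: mulr_ge0 => //; apply: mulr_ge0; first by rewrite mulr_ge0 ?powR_ge0.
  by apply: sumr_ge0 => i _; apply: sumr_ge0 => j _; exact: sqr_ge0.
move: (2^-1 * _) EE0 => E0 E00 h1 h2.
set Y := cutoff z L x ^+ k.+4.+1 * u x `^ (a - 1) * f (u x) * P x in h1 h2 *.
set G := cutoff z L x ^+ k.+3 * u x `^ a * P x in h1 h2 *.
have h3 : kappa * Y <= D' x + 2 * m ^+ 2 / L%:R ^+ 2 * G by lra.
have h4 := ler_wpM2l bk h3.
have h5 : 2 * (beta + a) / kappa * (kappa * Y) = 2 * (beta + a) * Y.
  by rewrite mulrA divfK// gt_eqF.
apply: (le_trans h2); rewrite -h5 /b; move: (_ / kappa) (L%:R ^+ 2) h4 => q l h4.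
lra.
Qed.

Lemma source_eq0 : f (u z) = 0.
Proof.
have half0 : 0 < 2^-1 :> R by [].
have [C C0 hC] := dominated_source_energy half0.
have i0 : 'I_n by exact: Ordinal (leq_trans (isT : (0 < 4)%N) n_ge4).
have cu : continuous u by case: (u_grad i0).
have cf : continuous (fun x => f (u x)).
  by case: (C1_along_weight u_grad u_gt0 f_deriv df_cont i0).
have : u z `^ a * f (u z) ^+ 2 = 0.
  apply: (@null_estimate_eq0 R n z (fun x => u x `^ a * f (u x) ^+ 2) k.+4.+1).
  - apply: continuous_mul; first exact: continuous_powRu.
    by under eq_fun do rewrite expr2; exact: continuous_mul.
  - by move=> x; apply: mulr_ge0; [exact: powR_ge0|exact: sqr_ge0].
  move=> eps e0.
  pose eta := sigma - n%:R; have eta0 : 0 < eta by rewrite subr_gt0.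
  (* With half of the energy moved to the left, [2 C L^(- sigma) (3 L)^n <= eps] is needed, that is
     [W <= L^(sigma - n)]. *)
  pose W := 2 * C * 3 ^+ n / eps.
  have W0 : 0 <= W by rewrite divr_ge0 ?(ltW e0)// !mulr_ge0// exprn_ge0.
  pose L := (n + Num.truncn (W `^ eta^-1)).+1.
  have L0 : (0 < L)%N by [].
  have L1 : 1 <= L%:R :> R by rewrite ler1n.
  have l0 : 0 < L%:R :> R by rewrite ltr0n.
  have WL : W <= L%:R `^ eta.
    have -> : W = (W `^ eta^-1) `^ eta.
      by rewrite -powRrM mulVf ?powRr1// gt_eqF.
    rewrite ge0_ler_powR ?nnegrE ?powR_ge0 ?(ltW eta0)//.
    apply: ltW; apply: (lt_le_trans (truncnS_gt _)).
    by rewrite ler_nat ltnS leq_addl.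
  have [D nD hD] := hC L L0.
  exists L, (fun x => 2 * D x), (2 * C * L%:R `^ (- sigma)); split.
  - by rewrite /L ltnS leq_addr.
  - exact: nullZ.
  - by rewrite !mulr_ge0 ?powR_ge0.
  - apply: (@le_trans _ _ (2 * C * L%:R `^ (- sigma) * (3 * L%:R) ^+ n)).
      rewrite ler_wpM2l ?mulr_ge0 ?powR_ge0//.
      by apply: lerXn2r; rewrite ?nnegrE; lra.
    have -> : 2 * C * L%:R `^ (- sigma) * (3 * L%:R) ^+ n = eps * W / L%:R `^ eta.
      have -> : L%:R `^ eta = L%:R `^ sigma / L%:R ^+ n.
        rewrite /eta powRD; last by rewrite (gt_eqF l0) implybT.
        by rewrite powRN powR_mulrn// ltW.
      rewrite powRN exprMn /W; field.
      by rewrite !gt_eqF ?powR_gt0 ?exprn_gt0.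
    by rewrite ler_pdivrMr ?powR_gt0// ler_wpM2l// ltW.
  move=> x; have := hD x; rewrite /source_energy -mulrA; lra.
move/eqP; rewrite mulf_eq0 gt_eqF ?powR_gt0//= sqrf_eq0 => /eqP //.
Qed.

End Unbounded.

(** * Reduction of both cases to the estimates above *)

Theorem theorem1p6 (R : realType) (n : nat) (f : R -> R) (beta : R)
  (n_gt2 : (2 < n)%N)
  (f_cont : {within `[0, +oo[, continuous f})
  (f_derivable : forall s : R, 0 < s -> derivable f s 1)
  (f'_cont : forall s : R, 0 < s -> {for s, continuous (derive1 f)})
  (f_zero : exists2 s : R, 0 <= s & f s = 0)
  (beta_gt1 : 1 < beta)
  (beta_subcritical : beta < (n%:R + 2) / (n%:R - 2))
  (f_beta : forall s : R, 0 < s -> 0 <= beta * f s - s * derive1 f s) :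
  (n = 3%N ->
     forall u : 'rV[R]_n -> R,
       positive_solution f u -> bounded_fun u ->
       exists c : R, u = cst c)
  /\
  (((4 <= n)%N /\
    exists2 alpha : R, 1 < alpha & \forall s \near +oo, s `^ alpha <= f s) ->
     (~ exists u : 'rV[R]_n -> R, positive_solution f u)
     /\
     forall c : R, 0 <= c ->
       (classical_solution f (cst c : 'rV[R]_n -> R) <-> c = 0)).
Proof.
have b0 : 0 <= beta by rewrite ltW// (lt_trans ltr01).
have fd (s : R) : 0 < s -> is_derive s 1 f (derive1 f s).
  by move=> s0; rewrite derive1E; apply/derivableP; exact: f_derivable.
split=> [n3 u usol ub|[n4 [al0 al01 fal]]].
  exact: (bounded_solution_const n3 f_derivable f'_cont b0 beta_subcritical f_beta usol ub).
have [M [_ fM]] := fal.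
pose s1 := Num.max 1 (M + 1).
have s11 : 1 <= s1 by rewrite le_max lexx.
have s10 : 0 < s1 by exact: lt_le_trans ltr01 s11.
have f_large s : s1 <= s -> s `^ al0 <= f s.
  move=> s1s; apply: fM; apply: (lt_le_trans _ s1s).
  by rewrite lt_max ltrDl ltr01 orbT.
(* Lowering the exponent is harmless where [s >= 1], and secures [alpha <= beta]. *)
pose alpha := Num.min al0 beta.
have al1 : 1 < alpha by rewrite lt_min al01.
have ab : alpha <= beta by rewrite ge_min lexx orbT.
pose c := Num.min 1 (f s1 / s1 `^ beta).
have fs1 : 0 < f s1 by rewrite (lt_le_trans _ (f_large _ (lexx _)))// powR_gt0.
have c0 : 0 < c by rewrite lt_min ltr01 divr_gt0// powR_gt0.
(* Up to [s1] the monotone ratio gives [f(s) / s^beta >= f(s1) / s1^beta]; beyond [s1] the growth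
   hypothesis applies. *)
have f_ge (s : R) : 0 < s -> c * s `^ alpha <= f s \/ c * s `^ beta <= f s.
  move=> s0; have [ss1|s1s] := leP s s1.
    right; have := powR_ratio_nincr fd f_beta s0 ss1.
    rewrite -ler_pdivrMr ?powR_gt0// mulrAC; apply: le_trans.
    by rewrite ler_wpM2r ?powR_ge0// ge_min lexx orbT.
  left; apply: (le_trans _ (f_large s (ltW s1s))).
  apply: (@le_trans _ _ (s `^ alpha)).
    by rewrite ler_piMl ?powR_ge0// ge_min lexx.
  by rewrite ler_powR ?ge_min ?lexx// (le_trans s11)// ltW.
have f_gt0 (s : R) : 0 < s -> 0 < f s by move=> s0; exact: (source_gt0 c0 f_ge s0).
(* As [f] is positive on the open half-line, its assumed zero must be 0. *)
have f0 : f 0 = 0.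
  have [s s0 fs] := f_zero; move: s0 fs; rewrite le_eqVlt => /predU1P[<-//|/f_gt0].
  by move=> fpos fs; rewrite fs ltxx in fpos.
split=> [[u [[uC2 ueq] u0]]|s s0].
  have lap x : \sum_i partial i (partial i u) x = - f (u x).
    by apply/eqP; rewrite -addr_eq0; apply/eqP; exact: ueq.
  have [delta [sigma [k [d0 sn e1 e2 gap]]]] := exponent_gap n4 al1 ab beta_subcritical.
  have := source_eq0 0 n4 (fun i => C2_grad i uC2) (fun i j => C2_hess i j uC2)
    u0 fd f'_cont lap f_beta beta_gt1 beta_subcritical c0 f_ge ab d0 sn e1 e2 gap.
  by move=> fu; have := f_gt0 _ (u0 0); rewrite fu ltxx.
have part0 (b : R) i : partial i (cst b : 'rV[R]_n -> R) = cst 0.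
  exact: (C1_along_partial (C1_along_cst i b)).
have C1cst (b : R) : C1 (cst b : 'rV[R]_n -> R).
  split; first exact: cst_continuous.
  move=> i; rewrite part0; split; last exact: cst_continuous.
  by move=> x; exact: derivable_cst.
split=> [[_ /(_ 0)]|->].
  rewrite /laplacian big1 ?add0r => [fs|i _]; last by rewrite !part0.
  move: s0; rewrite le_eqVlt => /predU1P[//|/f_gt0].
  by rewrite [f s]fs ltxx.
split; first by split=> // i; rewrite part0.
move=> x; rewrite /laplacian big1 ?add0r// => i _.
by rewrite !part0.
Qed.
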